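(* For every integer $\ell\ge2$, $$\frac{n^{\frac{3\ell}{6\ell-2}}}{(\log n)^{\frac{3\ell}{3\ell-1}}}\ll f_{6\ell,3}(n)-\pi(n)\ll n^{2/3}\log n$$ and $$\frac{n^{\frac{3\ell+1}{6\ell}}}{(\log n)^{\frac{3\ell+1}{3\ell}}}\ll f_{6\ell+3,3}(n)-\pi(n)\ll n^{2/3}\log n.$$
   Context: $\log$ is the natural logarithm, $\pi(n)$ is the number of primes not exceeding $n$. $X\ll Y$ means there is a constant $c>0$ (which may depend on $\ell$) with $X\le cY$ for all sufficiently large $n$. $f_{k,d}(n)$ is the maximal size of a set $A\subseteq\{1,\dots,n\}$ such that the equation $a_1a_2\cdots a_k=x^d$ (with $a_1,\dots,a_k\in A$ not necessarily distinct, $x$ an integer) has no solution except trivial ones, where a solution is trivial if the multiset $\{a_1,\dots,a_k\}$ can be partitioned into $d$-element sub-multisets each consisting of $d$ copies of the same number. *)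

(* Defs.v *)
From HB Require Import structures.
From mathcomp Require Import all_boot all_order all_algebra.
From mathcomp Require Import boolp classical_sets reals topology normedtype
  sequences exp.

Set Implicit Arguments.
Unset Strict Implicit.
Unset Printing Implicit Defensive.

Import Order.TTheory GRing.Theory Num.Theory.

Local Open Scope classical_set_scope.
Local Open Scope ring_scope.

(* [s] lists the common values of the blocks of [d] equal elements. *)
Definition trivial_solution (d : nat) (a : seq nat) : Prop :=
  exists s : seq nat, perm_eq a (flatten [seq nseq d b | b <- s]).

Definition only_trivial_solutions (k d : nat) (A : {pred nat}) : Prop :=
  forall (a : k.-tuple nat) (x : int),
    {subset a <= A} -> (\prod_(m <- a) m)%N%:Z = x ^+ d ->
    trivial_solution d a.

Definition nat_set (n : nat) (A : {set 'I_n.+1}) : {pred nat} :=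
  [pred m : nat | [exists i in A, val i == m]].

(* Subsets of {1, ..., n} are the sets of ordinals below n.+1 avoiding 0. *)
Definition f_max (k d n : nat) : nat :=
  \max_(A : {set 'I_n.+1} |
        (ord0 \notin A) && `[< only_trivial_solutions k d (nat_set A) >]) #|A|.

Definition prime_pi (n : nat) : nat := count prime (iota 1 n).

(* [X << Y], without absolute values; [c] and the threshold may depend on all
   parameters of [X] and [Y] other than [n]. *)
Definition ll (R : realType) (X Y : nat -> R) : Prop :=
  exists2 c : R, 0 < c & \forall n \near \oo, X n <= c * Y n.

(* Main.v *)
Require Import Defs.
From HB Require Import structures.
From mathcomp Require Import all_boot all_order all_algebra finfield.
From mathcomp Require Import ring lra zify.
From mathcomp Require Import boolp classical_sets reals topology normedtype
  sequences exp.
From mathcomp Require Import finset.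

(** Upper bound.  If A has only trivial solutions, then a1 a2 a3 = b1 b2 b3 in A
    forces a1 to occur among the other five numbers.  The elements u p of A with
    p > n^(2/3) prime are the edges of a graph without 4-cycles, so each pair of
    numbers u, v < n^(1/3) has at most one common prime, and there are at most
    pi(n) + O(n^(2/3)) such elements.  Every other element is u v with
    u, v <= n^(2/3); when u runs over a dyadic interval these are the edges of a
    bipartite graph in which two vertices are joined by at most one path of
    length 3, and counting these paths gives O(n^(2/3)) edges for each of the
    O(log n) intervals.

    Lower bound.  Take a bipartite graph whose vertices are primes p <= sqrt n,
    and let A consist of the products of adjacent primes together with all the
    primes that are not vertices.  In a nontrivial solution with k = 3 K factors,
    the edges of multiplicity prime to 3 form a subgraph of minimal degree at
    least 2 with at most K vertices on each side, hence a cycle of length at most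
    2 K.  So a graph of girth above 2 K gives a lower bound.  Such a graph is the
    coset graph of the subgroups [[1, a], [0, 1]] and [[1, 0], [a X, 1]] in
    SL_2(F_q[X]) modulo a congruence subgroup: an alternating word of length 2 d
    has trace of degree d in X, while a word congruent to 1 modulo X^m has, its
    determinant being 1, a trace congruent to 2 modulo X^(2 m).  The
    number of available primes is bounded below by Chebyshev's argument, and q is
    a power of 2. *)

Set Implicit Arguments.
Unset Strict Implicit.
Unset Printing Implicit Defensive.

Import Order.TTheory GRing.Theory Num.Theory.

(** * A bipartite graph of large girth *)

(** A graph is a type of edges with two end maps, and a walk is its sequence of edges. Parallel
    edges are thus allowed; two of them form a closed walk with d = 1. *)
Definition closed_walk (T U V : Type) (lend : T -> U) (rend : T -> V) (d : nat) (g : nat -> T) :=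
  g d.*2 = g 0 /\
  forall i, (i < d) ->
    [/\ lend (g i.*2) = lend (g i.*2.+1), g i.*2 <> g i.*2.+1,
        rend (g i.*2.+1) = rend (g i.*2.+2) & g i.*2.+1 <> g i.*2.+2].

Section PolyMod.
Local Open Scope ring_scope.
Variable F : fieldType.
Implicit Types p : {poly F}.

Lemma dvdXnP n p : reflect (forall i, (i < n)%N -> p`_i = 0) ('X^n %| p).
Proof.
apply: (iffP idP) => [/dvdpP[u ->] i lin|p0]; first by rewrite coefMXn lin.
rewrite -(poly_take_drop n p); apply: dvdp_add; last exact: dvdp_mulIr.
suff -> : take_poly n p = 0 by exact: dvdp0.
by apply/polyP => i; rewrite coef_take_poly coef0; case: ifP => // /p0.
Qed.

Lemma coprimep_Xn n p : p`_0 != 0 -> coprimep 'X^n p.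
Proof.
by move=> p0; rewrite coprimep_expl // coprimep_sym coprimepX rootE horner_coef0.
Qed.

Lemma Xn_inverse n p : p`_0 != 0 -> exists u, 'X^n %| u * p - 1.
Proof.
move=> p0; have := coprimep_Xn n p0.
case/Bezout_eq1_coprimepP => [[u v] /= uv1]; exists v.
by rewrite -uv1 opprD addrCA subrr addr0 -mulNr dvdp_mulIr.
Qed.

Lemma coef_subZ p q c i : (p - c *: q)`_i = p`_i - c * q`_i.
Proof. by rewrite coefB coefZ. Qed.

Lemma coef_subDC p q s c i : (p - (q + c%:P * s))`_i = p`_i - (q`_i + c * s`_i).
Proof. by rewrite coefB coefD coefCM. Qed.

End PolyMod.

Section Girth.
Local Open Scope ring_scope.
(* An edge is a matrix [[A, B], [C, D]] over F[X] with A(0) = 1, C(0) = 0 and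
   AD - BC = 1, where A, C, D are taken modulo X^(r+2) and B modulo X^(h+1).
   The edges sharing a left (right) end are the coset of the matrix modulo
   right multiplication by the [[1, a], [0, 1]] (the [[1, 0], [a X, 1]]). *)
Variables (F : fieldType) (r h : nat).
Hypotheses (rh : (r <= h)%N) (hr : (h <= r.+1)%N).

Definition edge := ('rV[F]_r.+1 * 'rV[F]_h.+1 * 'rV[F]_r.+1)%type.
Implicit Types e : edge.

Definition eA e : {poly F} := 1 + 'X * rVpoly e.1.1.
Definition eB e : {poly F} := rVpoly e.1.2.
Definition eC e : {poly F} := 'X * rVpoly e.2.

Lemma eA0 e : (eA e)`_0 = 1.
Proof. by rewrite coefD coef1 coefXM addr0. Qed.

Lemma eC0 e : (eC e)`_0 = 0.
Proof. by rewrite coefXM. Qed.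

(** D is not stored in an edge: A(0) = 1 makes A invertible modulo X^(r+2), so the determinant fixes
    D to that precision. *)
Lemma eD_exists e : exists D : {poly F}, 'X^(r.+2) %| eA e * D - eB e * eC e - 1.
Proof.
have [|u uA] := @Xn_inverse F r.+2 (eA e); first by rewrite eA0 oner_eq0.
exists (u * (1 + eB e * eC e)).
rewrite [X in _ %| X](_ : _ = (1 + eB e * eC e) * (u * eA e - 1)); last by ring.
exact: dvdp_mull.
Qed.

Definition eD e := xchoose (eD_exists e).

Lemma edet e : 'X^(r.+2) %| eA e * eD e - eB e * eC e - 1.
Proof. exact: xchooseP (eD_exists e). Qed.

(* Normal forms of the two cosets: the column operation is used to clear the
   constant coefficient of B (the linear coefficient of C). *)
Definition left_end e : 'rV[F]_r.+1 * 'rV[F]_h * 'rV[F]_r.+1 :=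
  (e.1.1, \row_(i < h) (eB e - (eB e)`_0 *: eA e)`_i.+1, e.2).

Definition right_end e : 'rV[F]_r.+1 * 'rV[F]_h.+1 * 'rV[F]_r :=
  (\row_(i < r.+1) (eA e - (eC e)`_1 *: ('X * eB e))`_i.+1, e.1.2,
   \row_(i < r) (eC e - (eC e)`_1 *: ('X * eD e))`_i.+2).

Lemma eB_inj e e' : 'X^(h.+1) %| eB e' - eB e -> e'.1.2 = e.1.2.
Proof.
move/dvdXnP => H; apply/rowP => i.
by have /eqP := H _ (ltn_ord i); rewrite coefB !coef_rVpoly_ord subr_eq0 => /eqP.
Qed.

Lemma eA_inj e e' : 'X^(r.+2) %| eA e' - eA e -> e'.1.1 = e.1.1.
Proof.
move/dvdXnP => H; apply/rowP => i.
have /eqP := H i.+1 (ltn_ord i).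
by rewrite coefB !coefD !coefXM /= !coef_rVpoly_ord subr_eq0 => /eqP/addrI.
Qed.

Lemma eC_inj e e' : 'X^(r.+2) %| eC e' - eC e -> e'.2 = e.2.
Proof.
move/dvdXnP => H; apply/rowP => i.
have /eqP := H i.+1 (ltn_ord i).
by rewrite coefB !coefXM /= !coef_rVpoly_ord subr_eq0 => /eqP.
Qed.

(** Equal normal forms leave only the constant coefficient of B free, and its change is a: the
    second matrix is the first one times [[1, a], [0, 1]]. The relation for D follows from the two
    determinants, A being a unit. *)
Lemma left_step e e' : left_end e = left_end e' -> e <> e' ->
  exists2 a : F, a != 0 &
    [/\ eA e' = eA e, eC e' = eC e,
        'X^(h.+1) %| eB e' - (eB e + a%:P * eA e) &
        'X^(r.+2) %| eD e' - (eD e + a%:P * eC e)].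
Proof.
case=> E1 Eb E2 ne; have EA : eA e' = eA e by rewrite /eA E1.
have EC : eC e' = eC e by rewrite /eC E2.
set a := (eB e')`_0 - (eB e)`_0.
have HB : 'X^(h.+1) %| eB e' - (eB e + a%:P * eA e).
  apply/dvdXnP => -[|i] lti.
    by rewrite coef_subDC eA0 mulr1 /a; ring.
  move/rowP: Eb => /(_ (Ordinal (lti : i < h)%N)); rewrite !mxE /=.
  rewrite coef_subDC !coef_subZ EA => /eqP; rewrite -subr_eq0 => /eqP Eb.
  by rewrite -[RHS]oppr0 -[in RHS]Eb /a; ring.
exists a.
  apply/eqP => a0; move: HB; rewrite a0 polyC0 mul0r addr0 => /eB_inj EB.
  by apply: ne; move: E1 E2 EB; case: (e) (e') => [[? ?] ?] [[? ?] ?] /= -> -> ->.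
split=> //.
have cA : coprimep 'X^(r.+2) (eA e) by apply: coprimep_Xn; rewrite eA0 oner_eq0.
rewrite -(Gauss_dvdpr _ cA).
rewrite [X in _ %| X](_ : _ = (eA e' * eD e' - eB e' * eC e' - 1) - (eA e * eD e - eB e * eC e - 1)
   + (eB e' - (eB e + a%:P * eA e)) * eC e); last by rewrite EA EC; ring.
apply: dvdp_add; first by apply: dvdp_sub; exact: edet.
(* C is divisible by X, so the congruence for B modulo X^(h+1) gains one power, and r <= h. *)
apply: dvdp_trans (_ : 'X^(h.+2) %| _); first by rewrite dvdp_exp2l.
rewrite exprSr; apply: dvdp_mul => //; exact: dvdp_mulIl.
Qed.

Lemma right_step e e' : right_end e = right_end e' -> e <> e' ->
  exists2 a : F, a != 0 &
    [/\ eB e' = eB e, 'X^(r.+2) %| eD e' - eD e,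
        'X^(r.+2) %| eA e' - (eA e + a%:P * ('X * eB e)) &
        'X^(r.+2) %| eC e' - (eC e + a%:P * ('X * eD e))].
Proof.
case=> EA E1 EC ne; have EB : eB e' = eB e by rewrite /eB E1.
set c := (eC e)`_1; set c' := (eC e')`_1; set a := c' - c.
have HA : 'X^(r.+2) %| eA e' - (eA e + a%:P * ('X * eB e)).
  apply/dvdXnP => -[|i] lti.
    by rewrite coef_subDC !eA0 coefXM /= mulr0 addr0 subrr.
  move/rowP: EA => /(_ (Ordinal (lti : i < r.+1)%N)); rewrite !mxE /=.
  rewrite EB -/c -/c' coef_subDC !coef_subZ => /eqP; rewrite -subr_eq0 => /eqP EA.
  by rewrite -[RHS]oppr0 -[in RHS]EA /a; ring.
have eD0 f : (eD f)`_0 = 1.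
  have /dvdXnP/(_ 0 isT)/eqP := edet f.
  by rewrite 2!coefB 2!coef0M eA0 eC0 mulr0 subr0 mul1r coef1 subr_eq0 => /eqP.
(* The normal forms compare C - c X D with C' - c' X D', so D' - D enters before it is known to
   vanish. *)
have HC : 'X^(r.+2) %| eC e' - (eC e + a%:P * ('X * eD e)) - c'%:P * ('X * (eD e' - eD e)).
  apply/dvdXnP => -[|[|i]] lti.
  - by rewrite coefB coef_subDC !eC0 coefCM !coefXM /=; ring.
  - by rewrite coefB coef_subDC -/c -/c' coefCM !coefXM /= coefB !eD0 /a; ring.
  move/rowP: EC => /(_ (Ordinal (lti : i < r)%N)); rewrite !mxE /=.
  rewrite -/c -/c' !coef_subZ ![('X * eD _)`_ _]coefXM /= => /eqP.
  rewrite -subr_eq0 => /eqP EC.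
  rewrite coefB coef_subDC coefCM mulrBr coefB ![('X * eD _)`_ _]coefXM /=.
  by rewrite -[RHS]oppr0 -[in RHS]EC /a; ring.
have HD : 'X^(r.+2) %| eD e' - eD e.
  (* The unit [u] absorbs the term c' X (D' - D) of [HC]; the two determinants, [HA] and [HC] then
     show that u (D' - D) vanishes modulo X^(r+2). *)
  set u := eA e + (a - c')%:P * ('X * eB e).
  have cu : coprimep 'X^(r.+2) u.
    by apply: coprimep_Xn; rewrite coefD eA0 coefCM coefXM mulr0 addr0 oner_eq0.
  rewrite -(Gauss_dvdpr _ cu).
  rewrite [X in _ %| X](_ : _ = (eA e' * eD e' - eB e' * eC e' - 1) - (eA e * eD e - eB e * eC e - 1)
    - eD e' * (eA e' - (eA e + a%:P * ('X * eB e)))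
    + eB e * (eC e' - (eC e + a%:P * ('X * eD e)) - c'%:P * ('X * (eD e' - eD e)))); last first.
    by rewrite EB /u polyCB; ring.
  apply: dvdp_add; last exact: dvdp_mull.
  apply: dvdp_sub; last exact: dvdp_mull.
  by apply: dvdp_sub; exact: edet.
have HC' : 'X^(r.+2) %| eC e' - (eC e + a%:P * ('X * eD e)).
  rewrite -(subrK (c'%:P * ('X * (eD e' - eD e))) (_ - _)).
  by apply: dvdp_add => //; rewrite dvdp_mull // dvdp_mull.
exists a => //; apply/eqP => a0; apply: ne.
move: HA HC'; rewrite a0 polyC0 !mul0r !addr0 => /eA_inj + /eC_inj; move: E1.
by case: (e) (e') => [[? ?] ?] [[? ?] ?] /= -> -> ->.
Qed.

(* [[P, Q], [R, S]] is the word in the two unipotent subgroups spelled by the walk. *)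
Lemma walk_word (g : nat -> edge) d :
  (forall i, (i < d)%N ->
    [/\ left_end (g i.*2) = left_end (g i.*2.+1), g i.*2 <> g i.*2.+1,
        right_end (g i.*2.+1) = right_end (g i.*2.+2) & g i.*2.+1 <> g i.*2.+2]) ->
  exists P Q R S : {poly F},
  [/\ [/\ size P = d.+1, (size Q <= d)%N, (size R <= d.+1)%N & (size S <= maxn d 1)%N],
      P * S - Q * R = 1,
      'X^(r.+2) %| eA (g d.*2) - (eA (g 0%N) * P + eB (g 0%N) * R) /\
      'X^(h.+1) %| eB (g d.*2) - (eA (g 0%N) * Q + eB (g 0%N) * S) &
      'X^(r.+2) %| eC (g d.*2) - (eC (g 0%N) * P + eD (g 0%N) * R) /\
      'X^(r.+2) %| eD (g d.*2) - (eC (g 0%N) * Q + eD (g 0%N) * S)].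
Proof.
elim: d => [|d IH] Hw.
  exists 1, 0, 0, 1; rewrite size_poly1 size_poly0 !mulr1 !mulr0 !addr0 !add0r !subrr.
  by rewrite !dvdp0 subr0.
have [i lid|P [Q [R [S [[sP sQ sR sS] det [HA HB] [HC HD]]]]]] := IH.
  by apply: Hw; rewrite ltnW.
have [lE ne1 rE ne2] := Hw d (ltnSn d).
have [a a0 [EA EC HB1 HD1]] := left_step lE ne1.
have [b b0 [EB HD2 HA2 HC2]] := right_step rE ne2.
rewrite doubleS; set g2 := g d.*2.+2 in HA2 HC2 EB HD2 *.
move: (g d.*2.+1) (g d.*2) HA HB HC HD EA EC HB1 HD1 EB HD2 HA2 HC2 => g1 g' HA HB HC HD EA EC HB1 HD1 EB HD2 HA2 HC2.
move: (g 0%N) HA HB HC HD => e HA HB HC HD.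
have aP : a%:P != 0 :> {poly F} by rewrite polyC_eq0.
have bP : b%:P != 0 :> {poly F} by rewrite polyC_eq0.
have Xlift (p : {poly F}) : 'X^(h.+1) %| p -> 'X^(r.+2) %| 'X * p.
  move=> Hp; apply: dvdp_trans (_ : 'X^(h.+2) %| _); first by rewrite dvdp_exp2l.
  by rewrite exprS dvdp_mul.
(* Right multiplication by [[1, a], [0, 1]], then by [[1, 0], [b X, 1]]. *)
set P' := P + a%:P * b%:P * ('X * P) + b%:P * ('X * Q).
set Q' := a%:P * P + Q; set R' := R + a%:P * b%:P * ('X * R) + b%:P * ('X * S).
set S' := a%:P * R + S.
have sCM (c : F) (p : {poly F}) : (size (c%:P * p)%R <= size p)%N by rewrite mul_polyC size_scale_leq.
have sXM (p : {poly F}) : (size ('X * p)%R <= (size p).+1)%N.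
  by rewrite mulrC; apply: leq_trans (size_polyMleq _ _) _; rewrite size_polyX addn2.
have P0 : P != 0 by rewrite -size_poly_gt0 sP.
exists P', Q', R', S'; split; [split| | |].
(* Only a b X P reaches degree d + 1, and a b is nonzero because consecutive edges differ. *)
- have sT : size (a%:P * b%:P * ('X * P)) = d.+2.
    by rewrite -polyCM mul_polyC ['X * P]mulrC size_scale ?mulf_neq0 // size_mulX // sP.
  rewrite /P' [P + _]addrC -addrA size_polyDl sT //.
  rewrite ltnS; apply: leq_trans (size_polyD _ _) _.
  rewrite geq_max sP leqnn /=; apply: leq_trans (sCM _ _) _.
  by apply: leq_trans (sXM _) _.
- apply: leq_trans (size_polyD _ _) _; rewrite geq_max (leq_trans (sCM _ _)) ?sP //=.
  by rewrite ltnW.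
- apply: leq_trans (size_polyD _ _) _; rewrite geq_max; apply/andP; split.
    apply: leq_trans (size_polyD _ _) _; rewrite geq_max (leq_trans sR) //=.
    by rewrite -polyCM; apply: leq_trans (sCM _ _) _; apply: leq_trans (sXM _) _.
  apply: leq_trans (sCM _ _) _; apply: leq_trans (sXM _) _.
  by rewrite ltnS; apply: leq_trans sS _; rewrite geq_max leqnSn.
- apply: leq_trans (size_polyD _ _) _; rewrite geq_max.
  rewrite (leq_trans (sCM _ _)) ?(leq_trans sR) ?leq_max ?leqnn //=.
  by rewrite (leq_trans sS) // geq_max leqnSn.
- by rewrite -[RHS]det /P' /Q' /R' /S'; ring.
- split.
    rewrite [X in _ %| X](_ : _ = (eA g2 - (eA g1 + b%:P * ('X * eB g1)))
      + b%:P * ('X * (eB g1 - (eB g' + a%:P * eA g')))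
      + b%:P * ('X * (eB g' - (eA e * Q + eB e * S)))
      + (1 + a%:P * b%:P * 'X) * (eA g' - (eA e * P + eB e * R))); last first.
      by rewrite EA /P' /R'; ring.
    apply: dvdp_add; last exact: dvdp_mull.
    apply: dvdp_add; last by apply: dvdp_mull; exact: Xlift.
    by apply: dvdp_add => //; apply: dvdp_mull; exact: Xlift.
  rewrite EB [X in _ %| X](_ : _ = (eB g1 - (eB g' + a%:P * eA g'))
    + (eB g' - (eA e * Q + eB e * S)) + a%:P * (eA g' - (eA e * P + eB e * R))).
    apply: dvdp_add; first exact: dvdp_add.
    apply: dvdp_mull; apply: dvdp_trans HA; exact: dvdp_exp2l.
  by rewrite /Q' /S'; ring.
- split.
    rewrite [X in _ %| X](_ : _ = (eC g2 - (eC g1 + b%:P * ('X * eD g1)))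
      + b%:P * 'X * (eD g1 - (eD g' + a%:P * eC g'))
      + b%:P * 'X * (eD g' - (eC e * Q + eD e * S))
      + (1 + a%:P * b%:P * 'X) * (eC g' - (eC e * P + eD e * R))); last first.
      by rewrite EC /P' /R'; ring.
    by do 3?apply: dvdp_add => //; rewrite dvdp_mull.
  rewrite [X in _ %| X](_ : _ = (eD g2 - eD g1) + (eD g1 - (eD g' + a%:P * eC g'))
    + (eD g' - (eC e * Q + eD e * S)) + a%:P * (eC g' - (eC e * P + eD e * R))).
    by do 3?apply: dvdp_add => //; rewrite dvdp_mull.
  by rewrite /Q' /S'; ring.
Qed.

(** The word of a closed walk is the identity up to the precision of the entries. Hence Q R vanishes
    to order (h + 1) + (r + 2), and (P - 1)(S - 1) at least to this order since h <= r + 1, whereas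
    the trace has in degree d the leading coefficient of P. *)
Lemma no_short_closed_walk d (g : nat -> edge) :
  (0 < d)%N -> closed_walk left_end right_end d g -> (r + h + 3 <= d)%N.
Proof.
move=> d0 [gd /walk_word[P [Q [R [S [[sP sQ sR sS] det]]]]]].
rewrite gd; move: (g 0%N) => e {g gd} [HA HB] [HC HD].
rewrite leqNgt; apply/negP => ltd.
set A := eA e in HA HB *; set B := eB e in HA HB *.
set C := eC e in HC HD *; set D := eD e in HC HD *.
(* The determinant [w] is a unit modulo powers of X; multiplying by it isolates P - 1, Q, R and S -
   1 as in Cramer's rule. *)
pose w := A * D - B * C.
have w0 : w`_0 != 0.
  have /dvdXnP/(_ 0 isT)/eqP := edet e.
  by rewrite -/A -/B -/C -/D -/w coefB coef1 subr_eq0 => /eqP->; rewrite oner_eq0.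
have cw n : coprimep 'X^n w by exact: coprimep_Xn.
have HCb (p : {poly F}) : 'X^(h.+1) %| p -> 'X^(r.+2) %| C * p.
  move=> Hp; apply: dvdp_trans (_ : 'X^(h.+2) %| _); first by rewrite dvdp_exp2l.
  by rewrite exprS dvdp_mul // dvdp_mulIl.
have P1 : 'X^(r.+2) %| P - 1.
  rewrite -(Gauss_dvdpr _ (cw _)).
  rewrite [X in _ %| X](_ : _ = B * (C - (C * P + D * R)) - D * (A - (A * P + B * R))).
    by apply: dvdp_sub; apply: dvdp_mull.
  by rewrite /w; ring.
have Q1 : 'X^(h.+1) %| Q.
  rewrite -(Gauss_dvdpr _ (cw _)).
  rewrite [X in _ %| X](_ : _ = B * (D - (C * Q + D * S)) - D * (B - (A * Q + B * S))).
    apply: dvdp_sub; apply: dvdp_mull => //; apply: dvdp_trans HD; exact: dvdp_exp2l.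
  by rewrite /w; ring.
have R1 : 'X^(r.+2) %| R.
  rewrite -(Gauss_dvdpr _ (cw _)).
  rewrite [X in _ %| X](_ : _ = C * (A - (A * P + B * R)) - A * (C - (C * P + D * R))).
    by apply: dvdp_sub; apply: dvdp_mull.
  by rewrite /w; ring.
have S1 : 'X^(r.+2) %| S - 1.
  rewrite -(Gauss_dvdpr _ (cw _)).
  rewrite [X in _ %| X](_ : _ = C * (B - (A * Q + B * S)) - A * (D - (C * Q + D * S))).
    by apply: dvdp_sub; [exact: HCb|exact: dvdp_mull].
  by rewrite /w; ring.
(* det = 1 makes the trace of a matrix close to 1 twice as close to 2. *)
have tr : 'X^(r + h + 3) %| P + S - 2%:R%:P.
  rewrite [X in _ %| X](_ : _ = Q * R - (P - 1) * (S - 1)).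
    rewrite (_ : r + h + 3 = h.+1 + r.+2)%N; last by lia.
    rewrite exprD; apply: dvdp_sub; first exact: dvdp_mul.
    by apply: dvdp_mul => //; apply: dvdp_trans P1; exact: dvdp_exp2l.
  by rewrite (_ : Q * R = P * S - 1); [rewrite polyC_natr; ring|rewrite -det; ring].
have /dvdXnP/(_ d ltd) := tr.
rewrite coefB coefD coefC (gtn_eqF d0) (nth_default 0 (_ : size S <= d)%N); last first.
  by apply: leq_trans sS _; rewrite geq_max leqnn.
rewrite subr0 addr0 => Pd.
have : lead_coef P = 0 by rewrite lead_coefE sP.
by move/eqP; rewrite lead_coef_eq0 => /eqP P0; move: sP; rewrite P0 size_poly0.
Qed.

End Girth.

(** * Closed walks in graphs of minimal degree two *)

Section ClosedWalk.
Variables (T : finType) (U V : eqType) (lend : T -> U) (rend : T -> V).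

(** An infinite walk without backtracking stays in S; among K + 1 successive left ends two coincide.
    A repetition at minimal distance closes up without backtracking. *)
Lemma closed_walk_exists (S : {set T}) (e0 : T) (C : seq U) K :
  e0 \in S ->
  (forall e, e \in S -> exists e', [/\ e' \in S, e <> e' & lend e = lend e']) ->
  (forall e, e \in S -> exists e', [/\ e' \in S, e <> e' & rend e = rend e']) ->
  {in S, forall e, lend e \in C} -> (size C <= K)%N ->
  exists d g, (0 < d <= K)%N /\ closed_walk lend rend d g.
Proof.
move=> Se0 Hl Hr HC sC.
have [f Hf] : exists f : bool -> T -> T, forall b e, e \in S ->
   [/\ f b e \in S, e <> f b e & if b then rend e = rend (f b e) else lend e = lend (f b e)].
  pose P b e e' := [&& e' \in S, e != e' & if b then rend e == rend e' else lend e == lend e'].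
  exists (fun b e => odflt e [pick e' | P b e e']) => b e Se.
  case: pickP => [e' /and3P[Se' /eqP ne] /=|no].
    by case: b => /eqP.
  case: b no => no.
    by have [e' [Se' /eqP ne /eqP E]] := Hr e Se; move: (no e'); rewrite /P Se' ne E.
  by have [e' [Se' /eqP ne /eqP E]] := Hl e Se; move: (no e'); rewrite /P Se' ne E.
have [e [Se ne elink]] : exists e : nat -> T, [/\ forall n, e n \in S,
    forall n, e n <> e n.+1 &
    forall n, if odd n then rend (e n) = rend (e n.+1) else lend (e n) = lend (e n.+1)].
  pose e := fix e n := if n is n'.+1 then f (odd n') (e n') else e0.
  have Se n : e n \in S by elim: n => //= n IH; case: (Hf (odd n) _ IH).
  by exists e; split=> // n; case: (Hf (odd n) _ (Se n)).
(* The vertex shared by edges i and i + 1 recurs 2 d edges later. Right ends count too, because the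
   minimality argument for [nec] moves one step on and so changes sides. *)
pose rep d i := if odd i then rend (e i) == rend (e (i + d.*2)) else lend (e i) == lend (e (i + d.*2)).
pose Q d := exists i, (0 < d)%N /\ rep d i.
have [d0 d0K [i0 [d00 rep0]]] : exists2 d, (d <= K)%N & Q d.
  pose s := [seq lend (e i.*2) | i <- iota 0 K.+1].
  have ns : ~~ uniq s.
    apply/negP => us; have : (size s <= size C)%N.
      by apply: uniq_leq_size => // x /mapP[i _ ->]; exact: HC.
    by rewrite size_map size_iota leqNgt ltnS sC.
  have [i [j [ij jK E]]] : exists i j, [/\ (i < j)%N, (j <= K)%N & lend (e i.*2) = lend (e j.*2)].
    case/(uniqPn (lend e0)): ns => i [j [ij]]; rewrite size_map size_iota => jK.
    rewrite !(nth_map 0%N) ?size_iota ?(ltn_trans ij) // !nth_iota ?(ltn_trans ij) //.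
    by move=> E; exists i, j; split.
  exists (j - i)%N; first lia.
  exists i.*2; split; first lia.
  by rewrite /rep odd_double E (_ : i.*2 + (j - i).*2 = j.*2)%N //; lia.
have [d [dK [i [d_gt0 repi]] dmin]] :
    exists d, [/\ (d <= K)%N, Q d & forall d', Q d' -> (d <= d')%N].
  have {i0 d00 rep0} : Q d0 by exists i0.
  elim/ltn_ind: d0 d0K => d IH dK Qd.
  have [[d' ltd Qd']|no] := pselect (exists2 d', (d' < d)%N & Q d').
    by apply: (IH d') => //; lia.
  exists d; split=> // d' Qd'; rewrite leqNgt; apply/negP => ltd; apply: no; by exists d'.
(* By minimality of [d], closing the walk does not backtrack. *)
have nec : e i.+1 <> e (i + d.*2).
  move=> E; case: d d_gt0 repi E dmin {dK} => // -[|d] _ repi E dmin.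
    by apply: (ne i.+1); rewrite E addnC.
  suff /dmin : Q d.+1 by rewrite ltnn.
  exists i.+1; split=> //; rewrite /rep addSn.
  have := elink (i + d.+1.*2).+1; rewrite (_ : (i + d.+1.*2).+2 = i + d.+2.*2)%N; last by lia.
  by rewrite -E /= oddD odd_double addbF; case: (odd i) => /= ->; rewrite eqxx.
exists d; case oi: (odd i) repi; rewrite /rep oi => /eqP repi.
  exists (fun n => if n == d.*2 then e i.+1 else e (i.+1 + n)%N).
  split; first by rewrite d_gt0.
  split; first by rewrite eqxx addn0; case: eqP => // _; rewrite addn0.
  move=> n ltn; have -> : (n.*2 == d.*2) = false by lia.
  have -> : (n.*2.+1 == d.*2) = false by lia.
  have l1 := elink (i.+1 + n.*2); have l2 := elink (i.+1 + n.*2.+1).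
  move: l1 l2; rewrite !oddD /= oi odd_double /= !(addnS, addSn) => l1 l2.
  have [En|nd] := eqVneq n.*2.+2 d.*2.
    rewrite (_ : (i + n.*2).+2 = i + d.*2)%N in l1 *; last by lia.
    split=> //; first by rewrite (_ : i + d.*2 = (i + n.*2).+2)%N; [exact: ne|lia].
      by rewrite -repi; have := elink i; rewrite oi.
    exact/nesym.
  by split; [|exact: ne| |exact: ne].
(* For even i the cycle formed by the edges i + 1, ..., i + 2 d is rotated by one edge, since
   [closed_walk] begins at a shared left end. *)
exists (fun n => if n == d.*2 then e i.+2 else if n == d.*2.-1 then e i.+1 else e (i.+2 + n)%N).
split; first by rewrite d_gt0.
split.
  have -> : (0 == d.*2)%N = false by lia.
  have -> : (0 == d.*2.-1)%N = false by lia.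
  by rewrite eqxx addn0.
move=> n ltn; have -> : (n.*2 == d.*2) = false by lia.
have -> : (n.*2 == d.*2.-1) = false by lia.
have l1 := elink (i.+2 + n.*2); have l2 := elink (i.+2 + n.*2.+1).
move: l1 l2; rewrite !oddD /= oi odd_double /= !(addnS, addSn) => l1 l2.
have -> : (n.*2.+1 == d.*2) = false by lia.
have [En|nd] := eqVneq n.*2.+1 d.*2.-1.
  have -> : n.*2.+2 == d.*2 by lia.
  rewrite (_ : (i + n.*2).+2 = i + d.*2)%N; last by lia.
  split; last exact: ne.
  - by rewrite -repi; have := elink i; rewrite oi.
  - exact/nesym.
  - by have := elink i.+1; rewrite /= oi.
have -> : (n.*2.+2 == d.*2) = false by lia.
have -> : (n.*2.+2 == d.*2.-1) = false by lia.
by split=> //; exact: ne.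
Qed.
End ClosedWalk.

(** * Sets of integers from graphs *)

Lemma count_mem_flatten_nseq (s : seq nat) (g : nat -> nat) (x : nat) : uniq s ->
  count_mem x (flatten [seq nseq (g m) m | m <- s]) = if x \in s then g x else 0.
Proof.
elim: s => //= m s IH /andP[ms us]; rewrite count_cat count_nseq IH // in_cons /= [m == x]eq_sym.
have [->|_] := eqVneq x m; last by rewrite mul0n add0n.
by rewrite (negPf ms) mul1n addn0.
Qed.

Lemma trivial_solutionP (d : nat) (a : seq nat) : 0 < d ->
  trivial_solution d a <-> forall m, d %| count_mem m a.
Proof.
move=> d0; have cf s m : count_mem m (flatten [seq nseq d b | b <- s]) = d * count_mem m s.
  elim: s => [|b s IH] /=; first by rewrite muln0.
  by rewrite count_cat count_nseq IH mulnDr mulnC.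
split=> [[s /permP ps] m|da]; first by rewrite ps cf dvdn_mulr.
exists (flatten [seq nseq (count_mem m a %/ d) m | m <- undup a]).
apply/allP => x _ /=; rewrite cf (@count_mem_flatten_nseq _ (fun m => count_mem m a %/ d)) ?undup_uniq //.
rewrite mem_undup; case: ifPn => [_|/count_memPn ->]; last by rewrite muln0.
by rewrite mulnC divnK.
Qed.

Lemma logn_prod_seq (p : nat) (s : seq nat) : {in s, forall m, 0 < m} ->
  logn p (\prod_(m <- s) m) = \sum_(m <- s) logn p m /\ 0 < \prod_(m <- s) m.
Proof.
elim: s => [|m s IH] sp; first by rewrite !big_nil logn1.
have [|E P] := IH; first by move=> x xs; apply: sp; rewrite inE xs orbT.
have m0 : 0 < m by apply: sp; rewrite inE eqxx.
by rewrite !big_cons lognM // E muln_gt0 m0 P.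
Qed.

Lemma prime_pi_card (n : nat) : prime_pi n = #|[set i : 'I_n.+1 | prime i]|.
Proof.
rewrite cardE /enum_mem size_filter -enumT.
rewrite -[LHS]/(count prime (iota 0 n.+1)) -val_enum_ord count_map.
by apply: eq_count => i; rewrite /= inE.
Qed.

Section Construction.
Variables (T U V : finType) (lend : T -> U) (rend : T -> V) (K n : nat).
Variable io : U + V -> nat.
Hypotheses (K0 : 0 < K) (io_inj : injective io) (io_prime : forall w, prime (io w)).
Hypothesis io_le : forall u v, io (inl u) * io (inr v) <= n.
Hypothesis no_walk : forall d g, 0 < d <= K -> ~ closed_walk lend rend d g.

Let prd e := io (inl (lend e)) * io (inr (rend e)).
Let inc e (w : U + V) := (w == inl (lend e)) || (w == inr (rend e)).

Let prd_gt0 e : 0 < prd e.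
Proof. by rewrite muln_gt0 !prime_gt0. Qed.

Let logn_prd e w : logn (io w) (prd e) = inc e w.
Proof.
rewrite lognM ?prime_gt0 // !logn_prime // !(inj_eq io_inj) /inc.
by case: w => w; [case: (inl w == inl _)|case: (inr w == inr _)].
Qed.

(** Unique factorization recovers the two ends, and distinct parallel edges would be a closed walk
    with d = 1 <= K. *)
Let prd_inj : injective prd.
Proof.
move=> e e' E; have H w : inc e w = inc e' w.
  by have := logn_prd e w; rewrite E logn_prd; case: inc; case: inc.
have El : lend e = lend e' by have := H (inl (lend e)); rewrite /inc !eqxx /= orbF => /esym/eqP[].
have Er : rend e = rend e' by have := H (inr (rend e)); rewrite /inc !eqxx /= => /esym/eqP[].
apply/eqP/negPn/negP => /eqP ne.
apply: (@no_walk 1 (fun i => if i == 1 then e' else e)); first by rewrite K0.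
by split=> // -[|//] _; split=> //=; exact/nesym.
Qed.

Let prd_not_prime e : ~~ prime (prd e).
Proof.
apply/negP => /primeP[_ /(_ (io (inl (lend e))) (dvdn_mulr _ (dvdnn _)))].
have l1 := prime_gt1 (io_prime (inl (lend e))).
have r1 := prime_gt1 (io_prime (inr (rend e))).
rewrite (gtn_eqF l1) /= /prd -{1}[io (inl _)]muln1 eqn_pmul2l ?prime_gt0 //.
by rewrite (ltn_eqF r1).
Qed.

Let used m := [exists w, m == io w].
Let good m := (prime m && ~~ used m) || [exists e, m == prd e].

Let good_gt0 m : good m -> 0 < m.
Proof. by case/orP=> [/andP[/prime_gt0]|/existsP[e /eqP->]]. Qed.

Let good_logn m w : good m -> logn (io w) m = \sum_(e | inc e w) (m == prd e).
Proof.
case/orP=> [/andP[pm nu]|/existsP[e0 /eqP->]].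
  rewrite logn_prime // big1 ?[io w == m]eq_sym => [|e _].
    by apply/eqP; rewrite eqb0; apply: contra nu => E; apply/existsP; exists w.
  by apply/eqP; rewrite eqb0; apply: contraL pm => /eqP->; exact: prd_not_prime.
rewrite logn_prd; case Hi: (inc e0 w).
  by rewrite (bigD1 e0) //= eqxx big1 // => e /andP[_ ne]; rewrite (inj_eq prd_inj) eq_sym (negPf ne).
rewrite big1 // => e ie; rewrite (inj_eq prd_inj).
by case: eqP => // E; rewrite E ie in Hi.
Qed.

(** The valuation at a vertex prime is the sum of the multiplicities of the incident edges, hence a
    multiple of 3; so an edge of multiplicity prime to 3 meets another such edge at each end. *)
Lemma walk_free_solutions (a : seq nat) (x : nat) :
  size a <= 3 * K -> {in a, forall m, good m} -> \prod_(m <- a) m = x ^ 3 ->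
  forall m, 3 %| count_mem m a.
Proof.
move=> sa ga Ex.
have slog p : 3 %| \sum_(m <- a) logn p m.
  have [|<- _] := @logn_prod_seq p a; first by move=> m /ga /good_gt0.
  by rewrite Ex lognX dvdn_mulr.
pose c e := count_mem (prd e) a.
have cinc w : 3 %| \sum_(e | inc e w) c e.
  rewrite (_ : \sum_(e | _) _ = \sum_(m <- a) logn (io w) m) //.
  rewrite (eq_big_seq _ (fun m ma => good_logn w (ga m ma))) exchange_big /=.
  by apply: eq_bigr => e _; rewrite /c -sum1_count big_mkcond /=; apply: eq_bigr => m _; case: eqP.
pose S := [set e | ~~ (3 %| c e)].
have S0 : S = set0.
  apply/eqP/set0Pn => -[e0 Se0].
  have nbr e w : e \in S -> inc e w -> exists e', [/\ e' \in S, e <> e' & inc e' w].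
    move=> Se ie; have := cinc w; rewrite (bigD1 e) //=.
    have [e' /and3P[Se' ne ie'] _|no] := pickP [pred e' | [&& e' \in S, e != e' & inc e' w]].
      by exists e'; split=> //; apply/eqP.
    rewrite dvdn_addl; first by move: Se; rewrite inE => /negPf->.
    apply: dvdn_sum => e' /andP[ie' ne]; have := no e'.
    by rewrite /= ie' eq_sym ne !andbT inE => /negPn.
  have [//|||//||d [g [dK cw]]] := @closed_walk_exists _ _ _ lend rend S e0 (enum (lend @: S)) K.
  - move=> e Se; have [|e' [Se' ne ie']] := nbr e (inl (lend e)) Se; first by rewrite /inc eqxx.
    by exists e'; split=> //; move: ie'; rewrite /inc orbF => /eqP[].
  - move=> e Se; have [|e' [Se' ne ie']] := nbr e (inr (rend e)) Se; first by rewrite /inc eqxx orbT.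
    by exists e'; split=> //; move: ie'; rewrite /inc => /eqP[].
  - by move=> e Se; rewrite mem_enum imset_f.
  (* At each left end of an edge of S the multiplicities add up to a positive multiple of 3, and
     over all left ends to at most 3 K. *)
  - rewrite -cardE -(leq_pmul2l (isT : 0 < 3)); apply: leq_trans sa.
    have -> : 3 * #|lend @: S| = \sum_(u in lend @: S) 3 by rewrite sum_nat_const mulnC.
    apply: (@leq_trans (\sum_(u in lend @: S) \sum_(e | lend e == u) c e)).
      apply: leq_sum => u /imsetP[e Se ->]; apply: dvdn_leq.
        rewrite (bigD1 e) //= addn_gt0; apply/orP; left.
        by move: Se; rewrite inE; case: (c e).
      have := cinc (inl (lend e)); rewrite /inc.
      by under eq_bigl do rewrite orbF eq_sym (inj_eq (@inl_inj _ _)).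
    apply: (@leq_trans (\sum_u \sum_(e | lend e == u) c e)).
      by rewrite [leqRHS](bigID (mem (lend @: S))) /= leq_addr.
    have <- : \sum_e c e = \sum_u \sum_(e | lend e == u) c e by rewrite (partition_big lend xpredT).
    rewrite (_ : \sum_e c e = \sum_(m <- a) \sum_e (m == prd e)); last first.
      by rewrite exchange_big; apply: eq_bigr => e _; rewrite /c -sum1_count big_mkcond /=; apply: eq_bigr => m _; case: eqP.
    rewrite -sum1_size; apply: leq_sum => m _.
    have [e /eqP Ee|no] := pickP [pred e | m == prd e].
      rewrite (bigD1 e) //= big1 ?addn0; first by case: eqP.
      by move=> e' ne; rewrite Ee (inj_eq prd_inj) eq_sym (negPf ne).
    by rewrite big1 // => e _; rewrite [_ == _]no.
  - exact: no_walk dK cw.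
(* Products of edges are settled by S being empty; a prime that labels no vertex divides no other
   admissible number, so its multiplicity is its valuation in the product. *)
move=> m; have [ma|/count_memPn->] := boolP (m \in a); last by rewrite dvdn0.
case/orP: (ga m ma) => [/andP[pm nu]|/existsP[e /eqP->]]; last first.
  by have := in_set0 e; rewrite -S0 inE => /negbFE.
have := slog m; rewrite (_ : \sum_(m' <- a) _ = count_mem m a) //.
rewrite -sum1_count [RHS]big_mkcond; apply: eq_big_seq => m' /ga /orP[/andP[pm' _]|].
  by rewrite logn_prime //= [m' == m]eq_sym; case: (m == m').
case/existsP=> e /eqP->; rewrite lognM ?prime_gt0 // !logn_prime //.
have nio w : (m == io w) = false.
  by apply/negP => E; move/negP: nu; apply; apply/existsP; exists w.
rewrite !nio /=; case: eqP => // E; by move: (prd_not_prime e); rewrite E pm.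
Qed.

(** The products contribute |T| new elements, and at most |U| + |V| primes are given up as
    labels. *)
Lemma f_max_construction :
  prime_pi n + #|T| <= f_max (3 * K) 3 n + (#|U| + #|V|).
Proof.
pose A := [set i : 'I_n.+1 | good i].
have gA : only_trivial_solutions (3 * K) 3 (nat_set A).
  move=> a x aA Ex; apply/trivial_solutionP => //.
  apply: (@walk_free_solutions a `|x|); first by rewrite size_tuple.
    by move=> m /aA /existsP[i /andP[]]; rewrite inE => gi /eqP <-.
  by rewrite -abszX -Ex.
have A0 : ord0 \notin A by rewrite inE; apply/negP => /good_gt0.
have lef : #|A| <= f_max (3 * K) 3 n.
  by apply: leq_bigmax_cond; rewrite A0; apply/asboolP.
have prd_lt e : prd e < n.+1 by rewrite ltnS io_le.
pose A1 := [set i : 'I_n.+1 | prime i & ~~ used i].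
pose A2 := [set Ordinal (prd_lt e) | e : T].
have -> : #|T| = #|A2|.
  by rewrite card_imset // => e e' [] /prd_inj.
have lepi : prime_pi n <= #|A1| + (#|U| + #|V|).
  rewrite prime_pi_card -(cardsID [set i : 'I_n.+1 | used i]) addnC.
  apply: leq_add; first by apply/subset_leq_card/fintype.subsetP => i; rewrite !inE andbC.
  rewrite -card_sum; apply: leq_trans (_ : #|[set (inord (io w) : 'I_n.+1) | w : U + V]| <= _); last first.
    by apply: leq_trans (leq_imset_card _ _) _.
  apply/subset_leq_card/fintype.subsetP => i; rewrite !inE => /andP[_ /existsP[w /eqP E]].
  by apply/imsetP; exists w => //; rewrite -E inord_val.
have dis : [disjoint A1 & A2].
  apply/pred0P => i /=; apply/negP => /andP[]; rewrite inE => /andP[pi _] /imsetP[e _ E].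
  by move: pi; rewrite E /= (negPf (prd_not_prime e)).
have sub : A1 :|: A2 \subset A.
  apply/fintype.subsetP => i /setUP[]; rewrite !inE /good; first by move=> ->.
  by move=> /imsetP[e _ ->]; apply/orP; right; apply/existsP; exists e.
have := subset_leq_card sub; rewrite cardsU (_ : A1 :&: A2 = set0) ?cards0; last first.
  by apply/eqP; rewrite setI_eq0.
lia.
Qed.

End Construction.

(** * The number of primes *)

(** In Legendre's formula the k-th term, floor(2h / p^k) - 2 floor(h / p^k), is at most 1, and it is
    0 once p^k > 2h. *)
Lemma logn_central_bin (p h : nat) : prime p -> 0 < h -> p ^ logn p 'C(h.*2, h) <= h.*2.
Proof.
move=> pp h0; have p1 := prime_gt1 pp.
set t := trunc_log p h.*2.
suff le_t : logn p 'C(h.*2, h) <= t.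
  apply: leq_trans (trunc_logP p1 (_ : 0 < h.*2)); last by rewrite double_gt0.
  by rewrite leq_exp2l.
have E : logn p 'C(h.*2, h) + (logn p h`!).*2 = logn p (h.*2)`!.
  have hle : h <= h.*2 by rewrite -addnn leq_addr.
  rewrite -(bin_fact hle) !lognM ?muln_gt0 ?fact_gt0 ?bin_gt0 ?hle //.
  by rewrite (_ : h.*2 - h = h) ?addnn //; lia.
suff : logn p (h.*2)`! <= (logn p h`!).*2 + t by lia.
have lt_pk k : h < k -> h %/ p ^ k = 0.
  by move=> hk; rewrite divn_small // (leq_trans hk) // ltnW // ltn_expl.
have -> : logn p h`! = \sum_(1 <= k < h.*2.+1) h %/ p ^ k.
  rewrite logn_fact // [RHS](big_cat_nat (n := h.+1)) //=; last by lia.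
  by rewrite [X in _ = _ + X]big_nat [X in _ = _ + X]big1 ?addn0 // => k /andP[hk _]; exact: lt_pk.
rewrite logn_fact // -[X in _ <= X + _]muln2 big_distrl /=.
have sumt N : \sum_(1 <= k < N.+1) (k <= t) <= minn N t.
  elim: N => [|N IH]; first by rewrite big_geq.
  by rewrite big_nat_recr //=; lia.
apply: leq_trans (leq_add (leqnn _) (leq_trans (sumt h.*2) (geq_minr _ _))).
rewrite -big_split; apply: leq_sum => k _ /=.
have pk : 0 < p ^ k by rewrite expn_gt0 prime_gt0.
have [le_k|lt_k] := leqP (p ^ k) h.*2.
  rewrite trunc_log_max //= -ltnS ltn_divLR //.
  have := divn_eq h (p ^ k); have := ltn_pmod h pk; move: (h %/ _) (h %% _) => x y; nia.
by rewrite divn_small.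
Qed.

Lemma central_bin_ge (h : nat) : 2 ^ h <= 'C(h.*2, h).
Proof.
elim: h => // h IH; rewrite doubleS binS binS expnS.
have : 'C(h.*2, h) <= 'C(h.*2.+1, h) by exact: leq_bin2l.
lia.
Qed.

(** The binomial coefficient is a product of at most pi(M) prime powers, each at most 2h <= M. *)
Lemma prime_pi_ge (M h : nat) : 0 < h -> h.*2 <= M -> 2 ^ h <= M ^ prime_pi M.
Proof.
move=> h0 hM; apply: leq_trans (central_bin_ge h) _.
have C0 : 0 < 'C(h.*2, h) by rewrite bin_gt0 -addnn leq_addr.
rewrite [X in X <= _](prod_prime_decomp C0) prime_decompE big_map.
apply: (@leq_trans (\prod_(p <- primes 'C(h.*2, h)) M)).
  rewrite big_seq [leqRHS]big_seq; apply: leq_prod => p.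
  rewrite mem_primes => /and3P[pp _ _].
  by apply: leq_trans (logn_central_bin pp h0) hM.
rewrite big_const_seq count_predT iter_muln_1 leq_pexp2l //; first by lia.
rewrite /prime_pi -size_filter; apply: uniq_leq_size; first exact: primes_uniq.
move=> p; rewrite mem_primes => /and3P[pp _ pC]; rewrite mem_filter pp mem_iota prime_gt0 //=.
rewrite add1n ltnS; apply: leq_trans hM.
have : p ^ 1 <= h.*2.
  by apply: leq_trans (logn_central_bin pp h0); rewrite leq_exp2l ?prime_gt1 // logn_gt0 mem_primes pp C0.
by rewrite expn1.
Qed.

(** Over the field with q = 2^j elements the coset graph has q^(2r+h+2) vertices on each side and q
    times as many edges; the vertices are labelled by distinct primes up to M. *)
Lemma f_max_lower (r h j n M : nat) : r <= h -> h <= r.+1 -> 0 < j -> M * M <= n ->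
  2 * (2 ^ j) ^ (r.*2 + h + 2) <= prime_pi M ->
  prime_pi n + (2 ^ j) ^ (r.*2 + h + 3) <=
    f_max (3 * (r + h + 2)) 3 n + 2 * (2 ^ j) ^ (r.*2 + h + 2).
Proof.
move=> rh hr j0 Mn qpi.
have [F _ cF] := pPrimePowerField (isT : prime 2) j0.
pose U : finType := ('rV[F]_r.+1 * 'rV[F]_h * 'rV[F]_r.+1)%type.
pose V : finType := ('rV[F]_r.+1 * 'rV[F]_h.+1 * 'rV[F]_r)%type.
pose T : finType := ('rV[F]_r.+1 * 'rV[F]_h.+1 * 'rV[F]_r.+1)%type.
have cU : #|U| = (2 ^ j) ^ (r.*2 + h + 2).
  by rewrite !card_prod !card_mx cF -!expnD; congr (_ ^ _); lia.
have cV : #|V| = (2 ^ j) ^ (r.*2 + h + 2).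
  by rewrite !card_prod !card_mx cF -!expnD; congr (_ ^ _); lia.
have cT : #|T| = (2 ^ j) ^ (r.*2 + h + 3).
  by rewrite !card_prod !card_mx cF -!expnD; congr (_ ^ _); lia.
pose s := [seq p <- iota 1 M | prime p].
have ss : size s = prime_pi M by rewrite size_filter.
pose io (w : U + V) := nth 0 s (enum_rank w).
have lt_io (w : U + V) : enum_rank w < size s.
  by apply: leq_trans (ltn_ord _) _; rewrite ss card_sum cU cV addnn -mul2n.
have sio w : io w \in s by exact: mem_nth.
have io_le w : io w <= M by have := sio w; rewrite mem_filter mem_iota; lia.
have := @f_max_construction T U V (@left_end F r h) (@right_end F r h) (r + h + 2) n io.
rewrite cT cU cV -mul2n addnn -mul2n; apply.
- by lia.
- move=> w w' /eqP; rewrite nth_uniq ?filter_uniq ?iota_uniq ?lt_io // => /eqP.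
  by move/val_inj/enum_rank_inj.
- by move=> w; have := sio w; rewrite mem_filter => /andP[].
- by move=> u v; apply: leq_trans Mn; exact: leq_mul.
- move=> d g dK cw; have : r + h + 3 <= d by apply: no_short_closed_walk cw; lia.
  lia.
Qed.

(** * The upper bound *)

Section PathCount.
Local Open Scope ring_scope.
Variables (R : realFieldType) (X Y : finType) (E : {set X * Y}).

Lemma AMGM3 (p q r : R) : 0 <= p -> 0 <= q -> 0 <= r -> 1 <= p * q * r -> 3 <= p + q + r.
Proof.
move=> p0 q0 r0 pqr; rewrite -(@ler_pXn2r _ 3) ?nnegrE ?addr_ge0 //.
apply: (@le_trans _ _ (27 * (p * q * r))); first by lra.
rewrite -subr_ge0.
rewrite (_ : _ - _ = (p + q + r) / 2 * ((p - q) ^+ 2 + (q - r) ^+ 2 + (r - p) ^+ 2)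
   + 3 * (p * (q - r) ^+ 2 + q * (p - r) ^+ 2 + r * (p - q) ^+ 2)); last by field.
by rewrite !(sqr_ge0, addr_ge0, mulr_ge0, invr_ge0).
Qed.

Let dX x := #|[set y | (x, y) \in E]|.
Let dY y := #|[set x | (x, y) \in E]|.

Hypothesis path_inj : forall x y x1 y1 x2 y2,
  (x, y1) \in E -> (x1, y1) \in E -> (x1, y) \in E ->
  (x, y2) \in E -> (x2, y2) \in E -> (x2, y) \in E ->
  x != x1 -> y != y1 -> x != x2 -> y != y2 -> x1 = x2 /\ y1 = y2.

(* The left side counts the paths of length 3 by their middle edge. *)
Lemma path_count : (\sum_(e in E) (dX e.1).-1 * (dY e.2).-1 <= #|X| * #|Y|)%N.
Proof.
pose P (e : X * Y) := setX [set x | (x, e.2) \in E & x != e.1] [set y | (e.1, y) \in E & y != e.2].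
have cP e : e \in E -> #|P e| = ((dX e.1).-1 * (dY e.2).-1)%N.
  move=> Ee; rewrite cardsX mulnC; congr (_ * _)%N.
    rewrite /dX (cardsD1 e.2 [set y | (e.1, y) \in E]) inE -surjective_pairing Ee /=.
    by apply: eq_card => y; rewrite !inE andbC.
  rewrite /dY (cardsD1 e.1 [set x | (x, e.2) \in E]) inE -surjective_pairing Ee /=.
  by apply: eq_card => x; rewrite !inE andbC.
rewrite -(eq_bigr _ cP) -card_prod.
pose Q := [set t : (X * Y) * (X * Y) | (t.1 \in E) && (t.2 \in P t.1)].
have -> : \sum_(e in E) #|P e| = #|Q|.
  rewrite -[RHS]sum1_card (partition_big (fun t => t.1) (mem E)) /=; last by move=> t; rewrite inE => /andP[].
  apply: eq_bigr => e Ee; rewrite -sum1_card.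
  rewrite (reindex_onto (fun uw => (e, uw)) (fun t => t.2)) /=.
    by apply: eq_bigl => uw; rewrite !inE !eqxx Ee !andbT.
  by move=> [e' uw] /andP[_ /eqP] /= ->.
have : {in Q &, injective snd}.
  move=> [[x1 y1] [x y]] [[x2 y2] [x' y']]; rewrite !inE /=.
  move=> /andP[E1 /andP[/andP[E2 n1] /andP[E3 n2]]] /andP[E4 /andP[/andP[E5 n3] /andP[E6 n4]]] [ex ey].
  rewrite -ex -ey in E5 E6 n3 n4 *.
  by have [-> ->] := path_inj E2 E1 E3 E5 E4 E6 n1 n2 n3 n4.
by move/card_in_imset <-; apply: max_card.
Qed.

(** The edges at a vertex of degree d carry b / d each, so no vertex contributes more than b. *)
Lemma sum_inv_dX (b : R) : 0 <= b -> \sum_(e in E) b / (dX e.1)%:R <= b * #|X|%:R.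
Proof.
move=> b0; rewrite (partition_big (fun e => e.1) xpredT) //= mulr_natr -[leRHS]sumr_const.
apply: ler_sum => x _.
rewrite (eq_bigr (fun _ => b / (dX x)%:R)); last by move=> e /andP[_ /eqP->].
rewrite sumr_const -[leLHS]mulr_natr.
rewrite (_ : #|_| = dX x).
  have [->|d0] := eqVneq (dX x) 0%N; first by rewrite mulr0.
  by rewrite divfK // pnatr_eq0.
have pinj : injective (pair x : Y -> X * Y) by move=> y y' [].
rewrite /dX -(card_imset [set y | (x, y) \in E] pinj).
apply: eq_card => -[x' y]; rewrite [LHS]unfold_in /=; apply/andP/imsetP => [[Ee /eqP /= Ex]|[y' + [-> ->]]].
  by exists y; rewrite ?inE -Ex.
by rewrite inE.
Qed.

Lemma sum_inv_dY (b : R) : 0 <= b -> \sum_(e in E) b / (dY e.2)%:R <= b * #|Y|%:R.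
Proof.
move=> b0; rewrite (partition_big (fun e => e.2) xpredT) //= mulr_natr -[leRHS]sumr_const.
apply: ler_sum => y _.
rewrite (eq_bigr (fun _ => b / (dY y)%:R)); last by move=> e /andP[_ /eqP->].
rewrite sumr_const -[leLHS]mulr_natr.
rewrite (_ : #|_| = dY y).
  have [->|d0] := eqVneq (dY y) 0%N; first by rewrite mulr0.
  by rewrite divfK // pnatr_eq0.
have pinj : injective (fun x : X => (x, y)) by move=> x x' [].
rewrite /dY -(card_imset [set x | (x, y) \in E] pinj).
apply: eq_card => -[x' y']; rewrite [LHS]unfold_in /=; apply/andP/imsetP => [[Ee /eqP /= Ex]|[x2 + [-> ->]]].
  by exists x'; rewrite ?inE -Ex.
by rewrite inE.
Qed.

Lemma edge_bound (c : R) : 0 < c -> (#|X| * #|Y|)%:R <= 4 * c ^+ 3 ->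
  #|E|%:R <= 22 * c ^+ 2 + #|X|%:R + #|Y|%:R.
Proof.
move=> c0 XY.
have [->|[e0 e0E]] := set_0Vmem E.
  by rewrite cards0 !addr_ge0 // mulr_ge0 // exprn_ge0 // ltW.
have m0 : 0 < #|X|%:R :> R by rewrite ltr0n; apply/card_gt0P; exists e0.1.
have k0 : 0 < #|Y|%:R :> R by rewrite ltr0n; apply/card_gt0P; exists e0.2.
set m : R := #|X|%:R in m0 *; set k : R := #|Y|%:R in k0 *.
have mk : m * k <= 4 * c ^+ 3 by rewrite -natrM.
(* The product of these weights is 4 c^3 / (m k) >= 1. The three sums come to at most 64 c^2, c^2 +
   3 m and c^2 + 3 k, and 22 = 66 / 3. *)
pose a := 4 / c; pose b := c ^+ 2 / m; pose g := c ^+ 2 / k.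
have a0 : 0 < a by rewrite divr_gt0.
have b0 : 0 < b by rewrite divr_gt0 // exprn_gt0.
have g0 : 0 < g by rewrite divr_gt0 // exprn_gt0.
have abg : 1 <= a * b * g.
  rewrite (_ : _ * _ = 4 * c ^+ 3 / (m * k)).
    by rewrite ler_pdivlMr ?mulr_gt0 // mul1r.
  by rewrite /a /b /g; field; rewrite !gt_eqF.
(* AM-GM for [a d d'], [b / d] and [g / d'], whose product is at least 1. *)
have key e : e \in E ->
    3 <= 4 * a * ((dX e.1).-1 * (dY e.2).-1)%:R + (b + 3) / (dX e.1)%:R + (g + 3) / (dY e.2)%:R.
  move=> Ee; have D0 : (0 < dX e.1)%N.
    by apply/card_gt0P; exists e.2; rewrite inE -surjective_pairing.
  have D0' : (0 < dY e.2)%N.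
    by apply/card_gt0P; exists e.1; rewrite inE -surjective_pairing.
  move: (dX e.1) (dY e.2) D0 D0' => [//|D] [//|D'] _ _ /=.
  have p1 : 0 <= 4 * a * (D * D')%:R by rewrite mulr_ge0 ?ler0n // mulr_ge0 // ltW.
  have p2 (x : R) n : 0 < x -> 0 <= (x + 3) / n.+1%:R.
    by move=> x0; rewrite divr_ge0 // addr_ge0 // ltW.
  (* If one degree is 1, the product vanishes and the extra 3 over that degree suffices. Otherwise d
     <= 2 (d - 1) for both degrees, at the cost of the factor 4. *)
  case: D p1 => [|D] p1.
    by have := p2 g D' g0; rewrite mul0n mulr0 divr1; move: ((g + 3) / _) b0 => z b0; lra.
  case: D' p1 => [|D'] p1.
    by have := p2 b D.+1 b0; rewrite muln0 mulr0 divr1; move: ((b + 3) / _) g0 => z g0; lra.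
  have le3 : 3 <= a * (D.+2 * D'.+2)%:R + b / D.+2%:R + g / D'.+2%:R.
    apply: AMGM3.
    - by apply: mulr_ge0; [exact: ltW|exact: ler0n].
    - by apply: divr_ge0; [exact: ltW|exact: ler0n].
    - by apply: divr_ge0; [exact: ltW|exact: ler0n].
    have x0 : D.+2%:R != 0 :> R by rewrite pnatr_eq0.
    have y0 : D'.+2%:R != 0 :> R by rewrite pnatr_eq0.
    rewrite natrM; move: (D.+2%:R) (D'.+2%:R) x0 y0 => x y x0 y0.
    rewrite [leRHS](_ : _ = a * b * g) //; move: a b g {a0 b0 g0 abg p1} => a b g.
    by field; rewrite x0 y0.
  apply: (le_trans le3); apply: lerD; first apply: lerD.
  - rewrite (_ : 4 * a * _ = a * (4 * (D.+1 * D'.+1)%:R)); last first.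
      by rewrite [RHS]mulrCA mulrA.
    rewrite ler_pM2l // -natrM ler_nat (_ : 4 * _ = (2 * D.+1) * (2 * D'.+1))%N; last by ring.
    by apply: leq_mul; rewrite mul2n doubleS !ltnS -addnn leq_addr.
  - by rewrite ler_pM2r ?invr_gt0 // lerDl.
  - by rewrite ler_pM2r ?invr_gt0 // lerDl.
have : 3 * #|E|%:R <= 4 * a * (#|X| * #|Y|)%:R + (b + 3) * m + (g + 3) * k.
  rewrite mulr_natr -sumr_const; apply: (le_trans (ler_sum _ key)).
  rewrite !big_split /= -mulr_sumr -natr_sum.
  have b3 : 0 <= b + 3 by rewrite addr_ge0 // ltW.
  have g3 : 0 <= g + 3 by rewrite addr_ge0 // ltW.
  apply: lerD; [apply: lerD|exact: sum_inv_dY]; last exact: sum_inv_dX.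
  apply: ler_wpM2l; last by rewrite ler_nat path_count.
  by apply: mulr_ge0 => //; exact: ltW.
have -> : (b + 3) * m = c ^+ 2 + 3 * m by rewrite /b; field; rewrite gt_eqF.
have -> : (g + 3) * k = c ^+ 2 + 3 * k by rewrite /g; field; rewrite gt_eqF.
have : 4 * a * (#|X| * #|Y|)%:R <= 64 * c ^+ 2.
  rewrite (_ : 64 * c ^+ 2 = 4 * a * (4 * c ^+ 3)); first by apply: ler_wpM2l => //; apply: mulr_ge0 => //; exact: ltW.
  by rewrite /a; field; rewrite gt_eqF.
lra.
Qed.

End PathCount.

(** The equation is symmetric, so the conclusion for a1 says that each of the six numbers is
    repeated among the other five. *)
Definition cubic_sidon (A : {pred nat}) : Prop :=
  forall a1 a2 a3 b1 b2 b3, {subset [:: a1; a2; a3; b1; b2; b3] <= A} ->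
    a1 * a2 * a3 = b1 * b2 * b3 -> a1 \in [:: a2; a3; b1; b2; b3].

(* a1 a2 a3 (b1 b2 b3)^2 = (b1 b2 b3)^3, padded with cubes of a1; then a1 has a
   multiplicity prime to 3. *)
Lemma only_trivial_cubic_sidon (k : nat) (A : {pred nat}) : 3 <= k ->
  only_trivial_solutions (3 * k) 3 A -> cubic_sidon A.
Proof.
move=> k3 tA a1 a2 a3 b1 b2 b3 sA E; apply/negPn/negP => na.
pose s := [:: a1; a2; a3; b1; b1; b2; b2; b3; b3] ++ nseq (3 * (k - 3)) a1.
have ss : size s == 3 * k by rewrite size_cat size_nseq /=; lia.
have /trivial_solutionP : trivial_solution 3 (Tuple ss).
  apply: (tA _ (Posz (b1 * b2 * b3 * a1 ^ (k - 3)))).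
    move=> m; rewrite mem_cat => /orP[ms|/nseqP[-> _]]; apply: sA; last by rewrite inE eqxx.
    by move: ms; rewrite !inE => /or4P[->|->|->|/or4P[->|->|->|/or3P[->|->|->]]]; rewrite ?orbT.
  rewrite -[Posz (b1 * _ * _ * _)]natz -natrX natz; congr Posz.
  rewrite big_cat big_nseq iter_muln_1 /= !big_cons big_nil expnMn -expnM [(k - 3) * 3]mulnC.
  congr (_ * _); rewrite expnS -{1}E -mulnn; ring.
move=> /(_ isT a1) /=; rewrite count_nseq /= !eqxx mul1n.
move: na; rewrite !inE !negb_or => /and5P[n1 n2 n3 n4 n5].
rewrite ![_ == a1]eq_sym (negPf n1) (negPf n2) (negPf n3) (negPf n4) (negPf n5) !add0n.
by rewrite dvdn_addl ?dvdn_mulr.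
Qed.

Lemma small_factorization (n a : nat) : 0 < a -> a <= n ->
  (forall p, prime p -> p %| a -> p ^ 3 <= n ^ 2) ->
  exists u v, [/\ a = u * v, u ^ 3 <= n ^ 2 & v ^ 3 <= n ^ 2].
Proof.
move=> a0 an ap; have n0 : 0 < n by apply: leq_trans an.
pose Q d := (d %| a) && (d ^ 3 <= n ^ 2).
have Q1 : Q 1 by rewrite /Q dvd1n exp1n expn_gt0 n0.
have Qa d : Q d -> d <= a by case/andP => /dvdn_leq ->.
(* The largest divisor [d] of [a] with [d ^ 3 <= n ^ 2] works: if [d ^ 3 < n],
   then for a prime [p] dividing [a / d] both [p] and [d] are below [n ^ (1/3)],
   and [p * d] contradicts the maximality of [d]. *)
case: (ex_maxnP (ex_intro Q 1 Q1) Qa) => d /andP[da dn] dmax.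
exists d, (a %/ d); split=> //; first by rewrite mulnC divnK.
have d0 : 0 < d by rewrite (dvdn_gt0 a0).
have [nd|dn1] := leqP n (d ^ 3).
  have : (a %/ d) ^ 3 * d ^ 3 <= n ^ 3 by rewrite -expnMn divnK // leq_exp2r.
  move=> H; rewrite -(leq_pmul2r n0) -expnSr; apply: leq_trans H.
  by rewrite leq_mul2l nd orbT.
have [ad1|ad1] := leqP (a %/ d) 1.
  by apply: leq_trans (_ : 1 ^ 3 <= _); [rewrite leq_exp2r|rewrite expn_gt0 n0].
have pp := pdiv_prime ad1; set p := pdiv _ in pp.
have pad : p * d %| a by rewrite -(divnK da) dvdn_mul // pdiv_dvd.
have pa : p %| a by apply: dvdn_trans pad; exact: dvdn_mulr.
have pd : p <= d by apply: dmax; rewrite /Q pa ap.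
have : ~~ Q (p * d).
  apply/negP => /dmax; rewrite leqNgt => /negP; apply.
  by rewrite -[X in X < _]mul1n ltn_pmul2r // prime_gt1.
rewrite /Q pad /= -ltnNge expnMn => H.
have p3 : p ^ 3 <= d ^ 3 by rewrite leq_exp2r.
have : p ^ 3 * d ^ 3 <= n * n by apply: leq_mul; [exact: leq_trans p3 (ltnW dn1)|exact: ltnW].
by move: H; rewrite mulnn => /leq_trans H /H; rewrite ltnn.
Qed.

(** * Counting the elements with and without a large prime factor *)

Section Upper.
Variables (n : nat) (A : {set 'I_n.+1}).
Hypotheses (A0 : ord0 \notin A) (sA : cubic_sidon (nat_set A)).

Let memA (i : 'I_n.+1) : i \in A -> val i \in nat_set A.
Proof. by move=> iA; apply/existsP; exists i; rewrite iA /=. Qed.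

Let A_gt0 (i : 'I_n.+1) : i \in A -> 0 < i.
Proof. by rewrite lt0n; apply: contraL => /eqP i0; rewrite (_ : i = ord0) //; exact: val_inj. Qed.

Lemma sidon_ord (a1 a2 a3 b1 b2 b3 : 'I_n.+1) :
  {subset [:: a1; a2; a3; b1; b2; b3] <= A} ->
  a1 * a2 * a3 = b1 * b2 * b3 -> a1 \in [:: a2; a3; b1; b2; b3].
Proof.
move=> sub E; rewrite -(mem_map val_inj) /=; apply: sA E => m.
by rewrite -[[:: _; _; _; _; _; _]]/(map val [:: a1; a2; a3; b1; b2; b3]) => /mapP[i /sub iA ->]; exact: memA.
Qed.

Definition has_big_prime (i : 'I_n.+1) := [exists p : 'I_n.+1, [&& prime p, p %| i & n ^ 2 < p ^ 3]].

(** For each prime one chosen element is charged to the prime itself. Any further element u p is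
    charged to the pair (u', u), where u' p is the element chosen for p; two primes with the same
    pair would give a 4-cycle. *)
Lemma card_big_prime (t : nat) : (forall u, u ^ 3 <= n -> u <= t) ->
  #|[set i in A | has_big_prime i]| <= prime_pi n + t.+1 * t.+1.
Proof.
move=> ht; set B := [set i in A | has_big_prime i].
pose P (i : 'I_n.+1) : 'I_n.+1 := odflt ord0 [pick p : 'I_n.+1 | [&& prime p, p %| i & n ^ 2 < p ^ 3]].
pose u (i : 'I_n.+1) := i %/ P i.
have BP i : i \in B -> [/\ prime (P i), i = u i * P i :> nat & u i <= t].
  rewrite inE => /andP[iA /existsP[p hp]]; rewrite /u /P; case: pickP => [q /and3P[pq qi qn]|no] /=; last first.
    by have := no p; rewrite hp.
  split; rewrite ?divnK //; apply: ht.
  have n0 : 0 < n by apply: leq_trans (A_gt0 iA) (leq_ord i).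
  have : (i %/ q) ^ 3 * q ^ 3 <= n ^ 3 by rewrite -expnMn divnK // leq_exp2r // leq_ord.
  move=> H; rewrite -(@leq_pmul2r (n ^ 2)) ?expn_gt0 ?n0 // -expnS; apply: leq_trans H.
  by rewrite leq_mul2l ltnW ?orbT.
pose rep (p : 'I_n.+1) := odflt ord0 [pick i in B | P i == p].
have Brep i : i \in B -> rep (P i) \in B /\ P (rep (P i)) = P i.
  move=> iB; rewrite /rep; case: pickP => [j /andP[jB /eqP]|no] //=.
  by have := no i; rewrite iB eqxx.
pose f i : 'I_n.+1 + 'I_t.+1 * 'I_t.+1 :=
  if i == rep (P i) then inl (P i) else inr (inord (u (rep (P i))), inord (u i)).
have finj : {in B &, injective f}.
  move=> i j iB jB; rewrite /f.
  case: eqP => [Ei|ni]; case: eqP => [Ej|nj] //; first by case=> E; rewrite Ei Ej E.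
  have [riB Pri] := Brep i iB; have [rjB Prj] := Brep j jB.
  have [_ iE iut] := BP i iB; have [_ jE jut] := BP j jB.
  have [_ riE riut] := BP _ riB; have [_ rjE rjut] := BP _ rjB.
  case=> /(congr1 val); rewrite /= !inordK // => E1 /(congr1 val); rewrite /= !inordK // => E2.
  apply: val_inj; rewrite /= iE jE E2; congr (_ * _).
  apply/eqP/negPn/negP => nP.
  have BA x : x \in B -> x \in A by rewrite inE => /andP[].
  (* The 4-cycle relation i * rep (P j) = rep (P i) * j, with a factor j added on both sides. *)
  have := @sidon_ord i (rep (P j)) j (rep (P i)) j j.
  rewrite !inE; have -> : i == rep (P j) = false.
    by apply/eqP => Eij; move: nP; rewrite Eij Prj eqxx.
  have -> : (i == j) = false by apply/eqP => Eij; move: nP; rewrite Eij eqxx.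
  have -> : (i == rep (P i)) = false by apply/eqP.
  move=> H; suff : false by []; apply: H.
    by move=> x; rewrite !inE => /or4P[|||/or3P[]] /eqP-> ; apply: BA.
  rewrite riE rjE Pri Prj iE E1 E2 jE; ring.
rewrite -(card_in_imset finj).
apply: (@leq_trans #|[set inl p | p in [set p : 'I_n.+1 | prime p]] :|: [set inr uv | uv : 'I_t.+1 * 'I_t.+1]|).
  apply/subset_leq_card/fintype.subsetP => x /imsetP[i iB ->]; rewrite inE /f.
  case: eqP => _; apply/orP; [left|right]; last exact: imset_f.
  by apply: imset_f; rewrite inE; case: (BP i iB).
apply: leq_trans (leq_card_setU _ _).1 _; apply: leq_add.
  by rewrite prime_pi_card; exact: leq_imset_card.
by apply: leq_trans (leq_imset_card _ _) _; rewrite card_prod !card_ord.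
Qed.

(** As v <= n / 2^k, the two sides have at most 2^(k+1) and n / 2^k + 1 vertices, with product at
    most 4 n = 4 c^3. Each side has at most 2 c^2 vertices, whence 26 = 22 + 2 + 2. *)
Lemma dyadic_edges (R : realFieldType) (c : R) (k : nat) (C : {set 'I_n.+1})
    (u v : 'I_n.+1 -> nat) :
  (0 < c)%R -> (c ^+ 3 = n%:R)%R -> 2 ^ k <= n -> C \subset A ->
  (forall i, i \in C -> [/\ i = u i * v i :> nat, u i ^ 3 <= n ^ 2, v i ^ 3 <= n ^ 2 &
      2 ^ k <= u i < 2 ^ k.+1]) ->
  (#|C|%:R <= 26 * c ^+ 2)%R.
Proof.
move=> c0 c3 kn CA Cuv; have n0 : 0 < n by apply: leq_trans kn; rewrite expn_gt0.
pose Q s := s ^ 3 <= n ^ 2.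
have Q0 : Q 0 by [].
have Qn s : Q s -> s <= n ^ 2.
  by apply: leq_trans; rewrite -[X in X <= _]expn1; case: s => // s; rewrite leq_pexp2l.
(* [s] is the integer part of n^(2/3) = c^2. *)
case: (ex_maxnP (ex_intro Q 0 Q0) Qn) => s Qs smax.
have sc : (s.+1%:R <= 2 * c ^+ 2 :> R)%R.
  have c1 : (1 <= c)%R.
    by rewrite -(@ler_pXn2r _ 3) ?nnegrE ?(ltW c0) // expr1n c3 ler1n.
  have : (s%:R <= c ^+ 2 :> R)%R.
    rewrite -(@ler_pXn2r _ 3) ?nnegrE ?exprn_ge0 ?(ltW c0) // -exprM mulnC exprM c3.
    by rewrite -!natrX ler_nat.
  have : (1 <= c ^+ 2)%R by rewrite exprn_ege1.
  by rewrite -natr1; lra.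
pose m := minn (2 ^ k.+1).-1 s; pose l := minn (n %/ 2 ^ k) s.
have pk : 0 < 2 ^ k by rewrite expn_gt0.
have um i : i \in C -> u i <= m /\ v i <= l.
  move=> iC; have [iE us vs /andP[ku uk]] := Cuv i iC.
  rewrite !leq_min !smax // !andbT; split; first by rewrite -ltnS prednK ?expn_gt0.
  rewrite leq_divRL //; apply: leq_trans (leq_ord i); rewrite iE mulnC.
  by rewrite leq_mul2r ku orbT.
pose f i : 'I_m.+1 * 'I_l.+1 := (inord (u i), inord (v i)).
have fP x y : (x, y) \in f @: C -> exists i, [/\ i \in C, u i = x & v i = y].
  case/imsetP=> i iC [-> ->]; exists i; have [ui vi] := um i iC.
  by rewrite !inordK.
have finj : {in C &, injective f}.
  move=> i j iC jC [] /(congr1 val) /=; have [ui vi] := um i iC; have [uj vj] := um j jC.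
  rewrite !inordK // => Eu /(congr1 val) /=; rewrite !inordK // => Ev.
  by apply: val_inj; have [/= -> _ _ _] := Cuv i iC; have [-> _ _ _] := Cuv j jC; rewrite Eu Ev.
have ml : ((#|'I_m.+1| * #|'I_l.+1|)%:R <= 4 * c ^+ 3 :> R)%R.
  rewrite c3 -natrM ler_nat !card_ord.
  apply: (@leq_trans (2 ^ k.+1 * (n %/ 2 ^ k).+1)).
    by apply: leq_mul; rewrite ?ltnS ?geq_minl // -(prednK (_ : 0 < 2 ^ k.+1)) ?expn_gt0 // ltnS geq_minl.
  rewrite expnS; have := leq_trunc_div n (2 ^ k); lia.
have key : forall x y x1 y1 x2 y2,
  (x, y1) \in f @: C -> (x1, y1) \in f @: C -> (x1, y) \in f @: C ->
  (x, y2) \in f @: C -> (x2, y2) \in f @: C -> (x2, y) \in f @: C ->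
  x != x1 -> y != y1 -> x != x2 -> y != y2 -> x1 = x2 /\ y1 = y2.
  move=> x y x1 y1 x2 y2 /fP[a1 [C1 u1 v1]] /fP[b1 [D1 p1 q1]] /fP[a2 [C2 u2 v2]]
    /fP[b3 [D3 p3 q3]] /fP[a3 [C3 u3 v3]] /fP[b2 [D2 p2 q2]] n1 n2 n3 n4.
  have EC i : i \in C -> i = u i * v i :> nat by move=> /Cuv[].
  have ne_u (i j : 'I_n.+1) (x' y' : 'I_m.+1) : u i = x' -> u j = y' -> x' != y' -> (i == j) = false.
    by move=> ui uj; apply: contraNF => /eqP E; rewrite -val_eqE /= -ui -uj E.
  have ne_v (i j : 'I_n.+1) (x' y' : 'I_l.+1) : v i = x' -> v j = y' -> x' != y' -> (i == j) = false.
    by move=> ui uj; apply: contraNF => /eqP E; rewrite -val_eqE /= -ui -uj E.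
  have sub6 : {subset [:: a1; a2; a3; b1; b2; b3] <= A}.
    move=> i; rewrite !inE => H; apply: (fintype.subsetP CA).
    by move: H => /or4P[|||/or3P[]] /eqP->.
  have Eprod : a1 * a2 * a3 = b1 * b2 * b3.
    rewrite (EC a1 C1) (EC a2 C2) (EC a3 C3) (EC b1 D1) (EC b2 D2) (EC b3 D3).
    by rewrite u1 v1 u2 v2 u3 v3 p1 q1 p2 q2 p3 q3; ring.
  (* Two paths with the same ends form a hexagon whose alternate edges have equal products. If y1
     and y2 differ, the edge (x, y1) occurs only once; if only x1 and x2 differ, the edge (x1, y)
     does. *)
  have [Ey|ny] := eqVneq y1 y2; last first.
    have := sidon_ord sub6 Eprod; rewrite !inE (ne_u _ _ _ _ u1 u2) // (ne_u _ _ _ _ u1 u3) //.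
    by rewrite (ne_u _ _ _ _ u1 p1) // (ne_u _ _ _ _ u1 p2) // (ne_v _ _ _ _ v1 q3).
  split=> //; apply/eqP/negPn/negP => /eqP nx.
  have := @sidon_ord a2 a1 a3 b1 b2 b3; rewrite !inE.
  have n1' : x1 != x by rewrite eq_sym.
  have nx' : x1 != x2 by apply/eqP.
  rewrite (ne_u _ _ _ _ u2 u1) // (ne_u _ _ _ _ u2 u3) // (ne_v _ _ _ _ v2 q1) //.
  rewrite (ne_u _ _ _ _ u2 p2) // (ne_u _ _ _ _ u2 p3) //=.
  move=> H; suff : false by []; apply: H; last by rewrite -Eprod [a2 * a1]mulnC.
  by move=> i Hi; apply: sub6; move: Hi; rewrite !inE orbCA.
have := edge_bound key c0 ml; rewrite card_in_imset // !card_ord => /le_trans; apply.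
have : (m.+1%:R <= s.+1%:R :> R)%R by rewrite ler_nat ltnS geq_minr.
have : (l.+1%:R <= s.+1%:R :> R)%R by rewrite ler_nat ltnS geq_minr.
lra.
Qed.

Lemma card_no_big_prime (R : realFieldType) (c : R) : (0 < c)%R -> (c ^+ 3 = n%:R)%R ->
  (#|[set i in A | ~~ has_big_prime i]|%:R <= (trunc_log 2 n).+1%:R * (26 * c ^+ 2))%R.
Proof.
move=> c0 c3; set C := [set i in A | _].
have /choice[uv Huv] (i : 'I_n.+1) : exists w : nat * nat, i \in C ->
    [/\ i = w.1 * w.2 :> nat, w.1 ^ 3 <= n ^ 2 & w.2 ^ 3 <= n ^ 2].
  have [iC|] := boolP (i \in C); last by exists (0, 0).
  move: iC; rewrite inE => /andP[iA /existsPn nb].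
  have [|p pp pi|a [b [E1 E2 E3]]] := @small_factorization n i (A_gt0 iA); first exact: leq_ord.
    have := nb (inord p); rewrite inordK.
      by rewrite pp pi /= -leqNgt.
    by apply: leq_ltn_trans (ltn_ord i); apply: dvdn_leq pi; exact: A_gt0.
  by exists (a, b).
pose u i := (uv i).1; pose v i := (uv i).2.
pose L := trunc_log 2 n.
have kL i : i \in C -> 0 < u i /\ trunc_log 2 (u i) <= L.
  move=> iC; have [iE _ _] := Huv i iC.
  have i0 : 0 < i by apply: A_gt0; move: iC; rewrite inE => /andP[].
  move: i0 (leq_ord i); rewrite iE muln_gt0 => /andP[u0 v0] un; split=> //.
  by apply: leq_trunc_log; apply: leq_trans un; exact: leq_pmulr.
pose kk i : 'I_L.+1 := inord (trunc_log 2 (u i)).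
rewrite -sum1_card (partition_big kk xpredT) //= natr_sum.
rewrite mulr_natl -[X in (_ *+ X)%R]card_ord -sumr_const; apply: ler_sum => k _.
have nk : C = set0 \/ 2 ^ k <= n.
  have [->|[i iC]] := set_0Vmem C; first by left.
  right; have n0 : 0 < n.
    by apply: leq_trans (leq_ord i); apply: A_gt0; move: iC; rewrite inE => /andP[].
  by apply: leq_trans (trunc_logP (isT : 1 < 2) n0); rewrite leq_exp2l // leq_ord.
case: nk => [C0|nk].
  rewrite big1 ?mulr_ge0 ?exprn_ge0 ?(ltW c0) // => i.
  by rewrite C0 in_set0.
rewrite sum1dep_card; apply: (@dyadic_edges R c k _ u v) => //.
  by apply/fintype.subsetP => i; rewrite !inE => /andP[/andP[]].
move=> i; rewrite inE => /andP[iC /eqP ik]; have [iE u3 v3] := Huv i iC.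
have [u0 uL] := kL i iC.
split=> //; rewrite -ik inordK //; exact: trunc_log_bounds.
Qed.

End Upper.

(** * Asymptotics *)

Lemma exists_floor_root (d n : nat) : 0 < d -> exists s, s ^ d <= n < s.+1 ^ d.
Proof.
move=> d0; pose Q s := s ^ d <= n.
have Q0 : Q 0 by rewrite /Q exp0n.
have Qn s : Q s -> s <= n.
  apply: leq_trans; case: s => // s; rewrite -[X in X <= _]expn1 leq_pexp2l //.
case: (ex_maxnP (ex_intro Q 0 Q0) Qn) => s Qs smax; exists s.
by rewrite [_ <= _]Qs ltnNge; apply/negP => /smax; rewrite ltnn.
Qed.

Lemma prime_pi_le (m n : nat) : m <= n -> prime_pi m <= prime_pi n.
Proof. by move=> mn; rewrite /prime_pi -(subnKC mn) iotaD count_cat leq_addr. Qed.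

Lemma prime_pi_unbounded (k : nat) : exists m, k <= prime_pi m.
Proof.
elim: k => [|k [m km]]; first by exists 0.
have [p mp pp] := prime_above m; exists p.
rewrite -(subnKC (ltnW mp)) /prime_pi iotaD count_cat -addn1.
apply: leq_add => //; rewrite -has_count; apply/hasP; exists p => //.
by rewrite mem_iota; lia.
Qed.

Section Asymptotics.
Local Open Scope ring_scope.
Variable R : realType.

Lemma f_max_upper (k n : nat) (c : R) : (3 <= k)%N -> 1 <= c -> c ^+ 3 = n%:R ->
  (f_max (3 * k) 3 n)%:R <=
    (prime_pi n)%:R + (4 * c ^+ 2 + (trunc_log 2 n).+1%:R * (26 * c ^+ 2)).
Proof.
move=> k3 c1 c3; have c0 : 0 < c by apply: lt_le_trans c1.
set B := _ + (_ + _).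
have B0 : 0 <= B.
  by rewrite !addr_ge0 ?mulr_ge0 ?mulr_ge0 ?exprn_ge0 ?(ltW c0).
apply: (big_ind (fun m => m%:R <= B)) => //.
  by move=> x y Hx Hy; rewrite /maxn; case: ifP.
move=> A /andP[A0 /asboolP /(only_trivial_cubic_sidon k3) sA].
rewrite -(cardsID [set i | has_big_prime i]) natrD.
have [t /andP[tn nt]] := exists_floor_root n (isT : (0 < 3)%N).
have tc : t.+1%:R <= 2 * c.
  have : t%:R <= c by rewrite -(@ler_pXn2r _ 3) ?nnegrE ?(ltW c0) // c3 -natrX ler_nat.
  by rewrite -natr1; lra.
have Hb : #|A :&: [set i | has_big_prime i]|%:R <= (prime_pi n)%:R + 4 * c ^+ 2.
  rewrite (_ : A :&: _ = [set i in A | has_big_prime i]); last by apply/setP => i; rewrite !inE.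
  apply: (@le_trans _ _ (prime_pi n + t.+1 * t.+1)%:R).
    rewrite ler_nat; apply: card_big_prime => // u un.
    by rewrite -ltnS -(ltn_exp2r _ _ (isT : (0 < 3)%N)); exact: leq_ltn_trans un nt.
  rewrite natrD lerD2l natrM (_ : 4 * _ = (2 * c) * (2 * c)); last by ring.
  by apply: ler_pM.
have Hs : #|A :\: [set i | has_big_prime i]|%:R <= (trunc_log 2 n).+1%:R * (26 * c ^+ 2).
  rewrite (_ : A :\: _ = [set i in A | ~~ has_big_prime i]); last first.
    by apply/setP => i; rewrite !inE andbC.
  exact: card_no_big_prime.
by rewrite /B addrA; exact: lerD.
Qed.

Lemma ll_upper (k : nat) : (3 <= k)%N ->
  ll (fun n => (f_max (3 * k) 3 n)%:R - (prime_pi n)%:R : R)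
     (fun n => n%:R `^ (2 / 3) * ln n%:R).
Proof.
move=> k3; have l2 : 0 < ln 2 :> R by rewrite ln_gt0 // ltr1n.
(* With L the integer part of log2 n, (4 + 26 (L + 1)) ln 2 <= 30 ln 2 + 26 ln n <= 56 ln n. *)
exists (56 / ln 2); first by rewrite divr_gt0.
exists 2%N => // n /= n2.
have n0 : 0 < n%:R :> R by rewrite ltr0n; lia.
have n1 : 1 <= n%:R :> R by rewrite ler1n; lia.
pose c : R := n%:R `^ (1 / 3).
have c1 : 1 <= c by rewrite /c -[X in X <= _](powRr0 n%:R) ler_powR // divr_ge0.
have cX m : c ^+ m = n%:R `^ (m%:R / 3).
  by rewrite -powR_mulrn ?powR_ge0 // -powRrM; congr (_ `^ _); field.
have c3 : c ^+ 3 = n%:R by rewrite cX divff ?pnatr_eq0 // powRr1 ?ltW.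
rewrite lerBlDl; apply: (le_trans (f_max_upper k3 c1 c3)); rewrite lerD2l -cX.
set L := trunc_log 2 n.
have Ll : L%:R * ln 2 <= ln n%:R :> R.
  have : (2 ^ L)%:R <= n%:R :> R by rewrite ler_nat; apply: trunc_logP => //; lia.
  rewrite -ler_ln ?posrE ?n0 ?ltr0n ?expn_gt0 // natrX lnXn ?ltr0n //.
  by rewrite mulr_natl.
have ln2n : ln 2 <= ln n%:R :> R by rewrite ler_ln ?posrE // ler_nat.
have c20 : 0 <= c ^+ 2 by rewrite exprn_ge0 // (le_trans _ c1).
rewrite (_ : 56 / _ * _ = c ^+ 2 * (56 * ln n%:R) / ln 2); last by ring.
rewrite ler_pdivlMr // (_ : _ * ln 2 = c ^+ 2 * (30 * ln 2 + 26 * (L%:R * ln 2))); last first.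
  by rewrite -natr1; ring.
by apply: ler_wpM2l => //; lra.
Qed.

(** Chebyshev's bound with h = floor(M / 2): here sqrt n <= M + 1 <= 4 h, as M >= 3, and ln M <= ln
    n. *)
Lemma prime_pi_sqrt_ge (n M : nat) : (2 < M)%N -> (M ^ 2 <= n < M.+1 ^ 2)%N ->
  n%:R `^ 2^-1 / ln n%:R <= 4 / ln 2 * (prime_pi M)%:R :> R.
Proof.
move=> M3 /andP[Mn nM].
have nM' : (M <= n)%N by apply: leq_trans Mn; rewrite -mulnn leq_pmull; lia.
have l2 : 0 < ln 2 :> R by rewrite ln_gt0 // ltr1n.
have n0 : 0 < ln n%:R :> R by rewrite ln_gt0 // ltr1n; lia.
rewrite ler_pdivrMr // mulrAC [4 / _]mulrC -!mulrA ler_pdivlMl //.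
have H : (M./2)%:R * ln 2 <= (prime_pi M)%:R * ln n%:R :> R.
  have := @prime_pi_ge M M./2; rewrite half_gt0 => /(_ (ltnW M3)).
  have -> : (M./2.*2 <= M)%N by lia.
  move=> /(_ isT).
  have Mp : 0 < M%:R :> R by rewrite ltr0n; lia.
  have np : 0 < n%:R :> R by rewrite ltr0n; lia.
  rewrite -(@ler_nat R) !natrX => le2M.
  have : ln (2 ^+ M./2) <= ln (M%:R ^+ prime_pi M) :> R by rewrite ler_ln ?posrE ?exprn_gt0.
  rewrite !lnXn // -[ln 2 *+ _]mulr_natl -[ln M%:R *+ _]mulr_natl => /le_trans; apply.
  by rewrite ler_wpM2l // ler_ln ?posrE ?ler_nat.
have sn : n%:R `^ 2^-1 <= 4 * (M./2)%:R :> R.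
  apply: (@le_trans _ _ M.+1%:R); last by rewrite -natrM ler_nat; lia.
  rewrite -(@ler_pXn2r _ 2) ?nnegrE ?powR_ge0 // -powR_mulrn ?powR_ge0 // -powRrM.
  by rewrite mulVf ?pnatr_eq0 // powRr1 ?ler0n // -natrX ler_nat ltnW.
apply: (@le_trans _ _ (ln 2 * (4 * (M./2)%:R))); first exact: ler_wpM2l (ltW l2) _ _ sn.
by rewrite [leLHS](_ : _ = 4 * ((M./2)%:R * ln 2)) ?[ln n%:R * _]mulrC; [apply: ler_wpM2l|ring].
Qed.

(** The largest admissible power q of 2 makes q^d comparable to pi(sqrt n), and the gain is at least
    q^(d+1) / 2, where q^(d+1) = (q^d)^e. *)
Lemma ll_lower (r h : nat) : (r <= h)%N -> (h <= r.+1)%N ->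
  let D : R := (r.*2 + h + 2)%:R in
  ll (fun n => n%:R `^ ((D + 1) / D / 2) / ln n%:R `^ ((D + 1) / D))
     (fun n => (f_max (3 * (r + h + 2)) 3 n)%:R - (prime_pi n)%:R).
Proof.
move=> rh hr; set d := (r.*2 + h + 2)%N; move=> D; set e := (D + 1) / D.
have d0 : (0 < d)%N by rewrite /d addn2.
have D0 : 0 < D by rewrite ltr0n.
have e0 : 0 <= e by rewrite divr_ge0 ?addr_ge0 // ltW.
have l2 : 0 < ln 2 :> R by rewrite ln_gt0 // ltr1n.
(* 4 / ln 2 comes from Chebyshev's bound; 2^(d+1) is the loss in q^d from restricting q to powers of
   2. *)
pose G : R := 4 / ln 2 * 2 ^+ d.+1.
have G0 : 0 < G by rewrite mulr_gt0 ?divr_gt0 ?exprn_gt0.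
exists (2 * G `^ e); first by rewrite mulr_gt0 // powR_gt0.
(* For large n already q = 4 is admissible, and q >= 4 gives 2 * 2 q^d <= q^(d+1). *)
have [M0 hM0] := prime_pi_unbounded (2 * (2 ^ 2) ^ d).
exists ((maxn M0 3) ^ 2)%N => // n /= ltn.
have [M /andP[Mn nM]] := exists_floor_root n (isT : (0 < 2)%N).
have M0M : (maxn M0 3 <= M)%N.
  by rewrite -ltnS -(ltn_exp2r _ _ (isT : (0 < 2)%N)); apply: leq_ltn_trans nM.
have M3 : (2 < M)%N by apply: leq_trans M0M; rewrite leq_max leqnn orbT.
have piM : (2 * (2 ^ 2) ^ d <= prime_pi M)%N.
  by apply: leq_trans hM0 _; apply: prime_pi_le; apply: leq_trans M0M; rewrite leq_maxl.
pose Q j := (2 * (2 ^ j) ^ d <= prime_pi M)%N.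
have Qb j : Q j -> (j <= prime_pi M)%N.
  apply: leq_trans; rewrite -expnM; apply: leq_trans (_ : 2 ^ (j * d) <= _)%N; last by rewrite leq_pmull.
  by apply: leq_trans (ltnW (ltn_expl _ _)); rewrite ?leq_pmulr.
case: (ex_maxnP (ex_intro Q 2 piM) Qb) => j Qj jmax.
have j2 : (2 <= j)%N by exact: jmax.
have jlt : (prime_pi M < 2 * (2 ^ j.+1) ^ d)%N.
  by rewrite ltnNge; apply/negP => /jmax; rewrite ltnn.
have := @f_max_lower r h j n M rh hr (ltnW j2); rewrite mulnn => /(_ Mn Qj).
rewrite (_ : r.*2 + h + 3 = d.+1)%N; last by rewrite /d; lia.
rewrite -/d; set q := (2 ^ j)%N => main.
have q4 : (4 <= q)%N by rewrite (_ : 4 = 2 ^ 2)%N // leq_exp2l.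
have main' : (q ^ d.+1)%:R <= 2 * ((f_max (3 * (r + h + 2)) 3 n)%:R - (prime_pi n)%:R) :> R.
  have : (2 * (2 * q ^ d) <= q ^ d.+1)%N by rewrite mulnA expnS leq_mul2r q4 orbT.
  by move: main; rewrite -!(@ler_nat R) !natrD; lra.
have piq : (prime_pi M)%:R <= 2 ^+ d.+1 * (q ^ d)%:R :> R.
  rewrite -natrX -natrM ler_nat; apply: leq_trans (ltnW jlt) _.
  by rewrite /q expnS expnMn mulnA -expnS.
have ln_n0 : 0 < ln n%:R :> R.
  by rewrite ln_gt0 // ltr1n; apply: leq_trans Mn; apply: leq_trans (_ : 3 ^ 2 <= _)%N => //; rewrite leq_exp2r.
have root_le : n%:R `^ 2^-1 / ln n%:R <= G * (q ^ d)%:R :> R.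
  apply: le_trans (prime_pi_sqrt_ge M3 _) _; first by rewrite Mn.
  rewrite /G -[leRHS]mulrA; apply: ler_wpM2l => //; by rewrite divr_ge0 // ltW.
have Eq : ((q ^ d)%:R : R) `^ e = (q ^ d.+1)%:R.
  rewrite natrX -powR_mulrn // -powRrM (_ : d%:R * e = d.+1%:R).
    by rewrite powR_mulrn // natrX.
  by rewrite /e /D -natr1; field; rewrite pnatr_eq0 -lt0n.
have -> : n%:R `^ (e / 2) / ln n%:R `^ e = (n%:R `^ 2^-1 / ln n%:R) `^ e.
  rewrite [RHS]powRM ?powR_ge0 ?invr_ge0 ?(ltW ln_n0) // -powRrM [2^-1 * e]mulrC.
  by rewrite -[X in _ = _ * X `^ _]powR_inv1 ?(ltW ln_n0) // -powRrM mulN1r powRN.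
apply: le_trans (ge0_ler_powR e0 _ _ root_le) _; rewrite ?nnegrE.
- by rewrite divr_ge0 ?powR_ge0 // ltW.
- by apply: mulr_ge0; [exact: ltW|exact: ler0n].
rewrite powRM ?(ltW G0) // Eq [2 * _]mulrC -mulrA.
by apply: ler_wpM2l main'; rewrite powR_ge0.
Qed.

End Asymptotics.

Local Open Scope ring_scope.

Theorem theorem13 (R : realType) (l : nat) (hl : (2 <= l)%N) :
  let lr : R := l%:R in
  let diff (k n : nat) : R := (f_max k 3 n)%:R - (prime_pi n)%:R in
  let lower1 (n : nat) : R :=
    n%:R `^ (3 * lr / (6 * lr - 2)) / ln n%:R `^ (3 * lr / (3 * lr - 1)) in
  let lower2 (n : nat) : R :=
    n%:R `^ ((3 * lr + 1) / (6 * lr)) / ln n%:R `^ ((3 * lr + 1) / (3 * lr)) in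
  let upper (n : nat) : R := n%:R `^ (2 / 3) * ln n%:R in
  (ll lower1 (diff (6 * l)%N) /\ ll (diff (6 * l)%N) upper) /\
  (ll lower2 (diff (6 * l + 3)%N) /\ ll (diff (6 * l + 3)%N) upper).
Proof.
move=> lr diff lower1 lower2 upper.
(* With r = l - 1, the choices h = r and h = r + 1 give K = r + h + 2 = 2 l and 2 l + 1, with D = 3
   l - 1 and 3 l. *)
have [r lE] : exists r, l = r.+1 by exists l.-1; lia.
have lrE : lr = r%:R + 1 by rewrite /lr lE -natr1.
have r0 : 0 <= r%:R :> R by [].
have lr1 : 1 <= lr by rewrite lrE lerDr.
rewrite /diff (_ : 6 * l = 3 * (r + r + 2))%N; last by lia.
rewrite (_ : 3 * (r + r + 2) + 3 = 3 * (r + r.+1 + 2))%N; last by lia.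
split; split; try by apply: ll_upper; lia.
- have := @ll_lower R r r (leqnn r) (leqnSn r); rewrite /lower1.
  have -> : (r.*2 + r + 2)%:R = 3 * lr - 1 :> R by rewrite lrE -addnn !natrD; ring.
  have -> : (3 * lr - 1 + 1) / (3 * lr - 1) / 2 = 3 * lr / (6 * lr - 2).
    by field; apply/andP; split; rewrite gt_eqF //; lra.
  by rewrite subrK.
- have := @ll_lower R r r.+1 (leqnSn r) (leqnn _); rewrite /lower2.
  have -> : (r.*2 + r.+1 + 2)%:R = 3 * lr :> R.
    by rewrite lrE -addnn !natrD -natr1; ring.
  have -> : (3 * lr + 1) / (3 * lr) / 2 = (3 * lr + 1) / (6 * lr).
    by field; rewrite gt_eqF //; lra.
  by [].
Qed.
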